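(* Let $A=(A_{ij})\in\mathbb{R}_{\min}^{n\times n}$ be irreducible, $a=(a_{ij})\in\mathbb{C}^{n\times n}$, and let $\mathcal{A}\in\mathcal{C}^{n\times n}$ satisfy $(\mathcal{A}_\epsilon)_{ij}\simeq a_{ij}\epsilon^{A_{ij}}$ for all $i,j$. Let $\alpha_\ell$, $N^\ell$, $\hat A_\ell$, $\hat A$ be associated to $A$ as in the context, and let $s^\ell,r^\ell,t^\ell$, $\ell=1,\ldots,k$, be constructed with $G=G^c(\hat A)$ or, equivalently, with $G=\mathrm{Sat}(\hat A,V')$ for some eigenvector $V'$ of $\hat A$. Assume that the matrix $r^\ell$ is invertible for some $1\leq\ell\leq k$, that $\mu\neq0$ is a simple eigenvalue of $t^\ell$, and let $V$ be any eigenvector of $\hat A_\ell$. Then the equation $$(\mu E_{N^\ell}-a^{\mathrm{Sat}(\hat A_\ell,V)})\,w=0$$ has a unique solution $w=(w_j)\in\mathbb{C}^n\setminus\{0\}$ up to a multiplicative constant. Moreover, there is a unique eigenvalue $\mathcal{L}_\epsilon$ of $\mathcal{A}_\epsilon$ with asymptotics $\mathcal{L}_\epsilon\sim\mu\epsilon^{\alpha_\ell}$, and if $w_i\neq0$, any eigenvector $\mathcal{V}_\epsilon$ of $\mathcal{A}_\epsilon$ associated to this $\mathcal{L}_\epsilon$ satisfies $(\mathcal{V}_\epsilon)_i\neq0$ for $\epsilon$ small enough, and $$\frac{(\mathcal{V}_\epsilon)_j}{(\mathcal{V}_\epsilon)_i}\simeq\frac{w_j\epsilon^{V_j}}{w_i\epsilon^{V_i}}\qquad\text{for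 } j\in\{1,\ldots,n\}.$$
   Context: Asymptotics. $\mathcal{C}$ is the ring of germs at $0$ of continuous functions $f:(0,\epsilon_0)\to\mathbb{C}$ ($\epsilon_0>0$) such that $|f(\epsilon)|\leq\epsilon^{-k}$ on $(0,\epsilon_0)$ for some positive constant $k$. For a function $f$ of $\epsilon$, $b\in\mathbb{C}$, $B\in\mathbb{R}\cup\{+\infty\}$: $f(\epsilon)\simeq b\epsilon^B$ means $\lim_{\epsilon\to0}\epsilon^{-B}f(\epsilon)=b$ if $B\in\mathbb{R}$, and $f=0$ near $0$ if $B=+\infty$. (So the last display means $\epsilon^{V_i-V_j}(\mathcal{V}_\epsilon)_j/(\mathcal{V}_\epsilon)_i\to w_j/w_i$; eigenvectors $V$ of irreducible min-plus matrices have finite entries.) For $b\neq0$, $B\in\mathbb{R}$, $f(\epsilon)\sim b\epsilon^B$ means $\lim_{\epsilon\to0}\epsilon^{-B}f(\epsilon)=b$. Min-plus notions. $\mathbb{R}_{\min}=\mathbb{R}\cup\{+\infty\}$ with $a\oplus b=\min(a,b)$ and multiplication $ab=a+b$; matrix operations over $\mathbb{R}_{\min}$ are taken in this sense. For a finite set $L$ and an $L\times L$ matrix $B$ over $\mathbb{R}_{\min}$, $G(B)$ is the digraph with node set $L$ and an arc $(i,j)$ whenever $B_{ij}\neq+\infty$; $B$ is irreducible if $G(B)$ is strongly connected. (When $n=1$, the matrix $(+\infty)$ is excluded.) $\rho_{\min}(B)=\min_c|c|_B/|c|$ over circuits $c$ of $G(B)$, where $|c|_B$ is the sum of the entries of $B$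 along the arcs of $c$ and $|c|$ its number of arcs ($+\infty$ if there are no circuits); for irreducible $B$ it is the unique min-plus eigenvalue. Circuits attaining the minimum are critical; the critical graph $G^c(B)$ consists of the nodes (critical nodes) and arcs of critical circuits. An eigenvector of an irreducible $B$ is a vector $V\in\mathbb{R}_{\min}^L$, not identically $+\infty$, with $BV=\rho_{\min}(B)V$. The saturation graph $\mathrm{Sat}(B,V)$ has node set $L$ and an arc $(i,j)$ if $(BV)_i=B_{ij}+V_j$. Min-plus Schur complement: for $C\subset L$, $N=L\setminus C$, $\lambda\in\mathbb{R}$ with $\lambda\leq\rho_{\min}(B_{CC})$, $\mathrm{Schur}(C,\lambda,B)=B_{NN}\oplus B_{NC}(\lambda^{-1}B_{CC})^*\lambda^{-1}B_{CN}$, where $\lambda^{-1}M$ is $M$ with $\lambda$ subtracted from every entry and $M^*=I\oplus M\oplus M^2\oplus\cdots$. Construction from $A$: put $A_1=A$ and, for $\ell\geq1$, $\alpha_\ell=\rho_{\min}(A_\ell)$, $C_\ell$ the set of critical nodes of $A_\ell$, and, as long as $C_1\cup\cdots\cup C_\ell\neq\{1,\ldots,n\}$, $A_{\ell+1}=\mathrm{Schur}(C_\ell,\alpha_\ell,A_\ell)$. This stops at some $k\leq n$, and $\alpha_1<\cdots<\alpha_k$. Put $C^0=\emptyset$, $C^\ell=C_1\cup\cdots\cup C_\ell$, $N^\ell=\{1,\ldots,n\}\setminus C^{\ell-1}$. The matrix $\hat A_\ell$ is defined by $(\hat A_\ell)_{ij}=A_{ij}-\alpha_m$ if $i\in C_m$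 with $m<\ell$, and $(\hat A_\ell)_{ij}=A_{ij}-\alpha_\ell$ if $i\in N^\ell$; $\hat A=\hat A_k$. These matrices are irreducible with min-plus eigenvalue $0$. $E_{N^\ell}$ is the $n\times n$ complex diagonal matrix with $(E_{N^\ell})_{ii}=1$ if $i\in N^\ell$ and $0$ otherwise. Complex Schur complements: for a graph $G$ on $\{1,\ldots,n\}$ and $b\in\mathbb{C}^{n\times n}$, $b^G$ has entries $b_{ij}$ if $(i,j)\in G$ and $0$ otherwise. For a complex $L\times L$ matrix $s$ with $s_{CC}$ invertible, $\mathrm{Schur}(C,s)=s_{NN}-s_{NC}(s_{CC})^{-1}s_{CN}$, $N=L\setminus C$. Define $r^\ell=a^G_{C^{\ell-1},C^{\ell-1}}$ ($r^1$ is the empty matrix, considered invertible), $s^1=a^G$, $s^\ell=\mathrm{Schur}(C^{\ell-1},s^1)$ for $\ell=2,\ldots,k$ (well defined when $r^\ell$ is invertible; it is indexed by $N^\ell$), and $t^\ell=s^\ell_{C_\ell C_\ell}$. *)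

(* Defs.v *)
From HB Require Import structures.
From mathcomp Require Import all_boot all_order all_algebra.
From mathcomp Require Import complex.
From mathcomp Require Import all_classical all_reals all_analysis.

Set Implicit Arguments.
Unset Strict Implicit.
Unset Printing Implicit Defensive.

Import Order.TTheory GRing.Theory Num.Theory.
Import numFieldNormedType.Exports.

Local Open Scope ring_scope.

(** * The min-plus semiring R_min = R U {+oo}

    [Some x] is the real number [x] and [None] is [+oo].  The ring notations
    on [Rmin R] denote the min-plus operations: [+] is the minimum (with zero
    element [+oo]) and [*] is the usual addition (with unit element [Some 0]);
    [*m], [^+], [*:] and [1%:M] on matrices are understood accordingly. *)
Definition Rmin (R : realType) : Type := option R.

HB.instance Definition _ (R : realType) := Choice.copy (Rmin R) (option R).

Section RminSemiring.
Variable R : realType.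
Implicit Types x y z : Rmin R.

Definition rmin_add x y : Rmin R :=
  match x, y with
  | Some a, Some b => Some (Num.min a b)
  | Some _, None => x
  | None, _ => y
  end.

Definition rmin_mul x y : Rmin R :=
  match x, y with
  | Some a, Some b => Some (a + b)
  | _, _ => None
  end.

Fact rmin_addA : associative rmin_add.
Proof. by move=> [x|] [y|] [z|] //=; rewrite minA. Qed.

Fact rmin_addC : commutative rmin_add.
Proof. by move=> [x|] [y|] //=; rewrite minC. Qed.

Fact rmin_add0 : left_id (None : Rmin R) rmin_add.
Proof. by case. Qed.

HB.instance Definition _ :=
  GRing.isNmodule.Build (Rmin R) rmin_addA rmin_addC rmin_add0.

Fact rmin_mulA : associative rmin_mul.
Proof. by move=> [x|] [y|] [z|] //=; rewrite addrA. Qed.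

Fact rmin_mulC : commutative rmin_mul.
Proof. by move=> [x|] [y|] //=; rewrite addrC. Qed.

Fact rmin_mul1 : left_id (Some 0 : Rmin R) rmin_mul.
Proof. by case=> //= x; rewrite add0r. Qed.

Fact rmin_mulDl : left_distributive rmin_mul rmin_add.
Proof. by move=> [x|] [y|] [z|] //=; rewrite addr_minl. Qed.

Fact rmin_mul0 : left_zero (None : Rmin R) rmin_mul.
Proof. by []. Qed.

Fact rmin_1neq0 : (Some 0 : Rmin R) != 0.
Proof. by []. Qed.

HB.instance Definition _ :=
  GRing.Nmodule_isComNzSemiRing.Build (Rmin R)
    rmin_mulA rmin_mulC rmin_mul1 rmin_mulDl rmin_mul0 rmin_1neq0.

End RminSemiring.

Definition rmin_fin (R : realType) (x : R) : Rmin R := Some x.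

(** Real value of a finite element; [0] is a dummy value at [+oo]. *)
Definition rmin_val (R : realType) (x : Rmin R) : R := odflt 0 x.

Definition rmin_to_ereal (R : realType) (x : Rmin R) : \bar R :=
  if x is Some r then r%:E else +oo%E.

(** Infimum of a subset of R_min that is bounded below by a real number
    (otherwise the infimum is not in R_min, and the value is a dummy). *)
Definition rmin_inf (R : realType) (S : set (Rmin R)) : Rmin R :=
  if ereal_inf ((@rmin_to_ereal R @` S)%classic) is r%:E then rmin_fin r
  else None.

Section MinPlusMatrices.
Variables (R : realType) (n : nat).
Implicit Types (B : 'M[Rmin R]_n) (V : 'cV[Rmin R]_n) (c : seq 'I_n).

(** ** Graph, circuits, eigenvectors *)

Definition mp_arc B : rel 'I_n := fun i j => B i j != None.

Definition mp_irreducible B : Prop :=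
  (forall i j, connect (mp_arc B) i j) /\
  (n = 1%N -> forall i j, B i j != None).

(** A circuit is given by the sequence of its nodes; its last arc goes from
    the last node to the first one. *)
Definition circuit_arcs c : seq ('I_n * 'I_n) := zip c (rot 1 c).

Definition circuit B c : Prop := c != [::] /\ cycle (mp_arc B) c.

Definition circuit_weight B c : R :=
  \sum_(e <- circuit_arcs c) rmin_val (B e.1 e.2).

Definition circuit_mean B c : R := circuit_weight B c / (size c)%:R.

Definition rho_min B : Rmin R :=
  rmin_inf [set rmin_fin (circuit_mean B c) | c in [set c | circuit B c]]%classic.

Definition critical_circuit B c : Prop :=
  circuit B c /\ rmin_fin (circuit_mean B c) = rho_min B.

Definition critical_nodes B : {set 'I_n} :=
  finset (fun i => `[< exists2 c, critical_circuit B c & i \in c >]).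

Definition critical_graph B : rel 'I_n := fun i j =>
  `[< exists2 c, critical_circuit B c & (i, j) \in circuit_arcs c >].

(** [V != 0] says that [V] is not identically [+oo]. *)
Definition mp_eigenvector B V : Prop := V != 0 /\ B *m V = rho_min B *: V.

Definition sat_graph B V : rel 'I_n := fun i j =>
  (B *m V) i 0 == B i j * V j 0.

(** ** Min-plus Schur complement

    An L x L matrix, with L a subset of the nodes, is represented by the
    n x n matrix that extends it by [+oo]; this does not change its circuits,
    and turns products of blocks into products of n x n matrices. *)

Definition mp_block (X Y : {set 'I_n}) B : 'M[Rmin R]_n :=
  \matrix_(i, j) if (i \in X) && (j \in Y) then B i j else None.

Definition mp_star B : 'M[Rmin R]_n :=
  \matrix_(i, j) rmin_inf [set (B ^+ m) i j | m in [set: nat]]%classic.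

(** If [B] represents an L x L matrix, the rows and columns of [B] outside L
    are [+oo], so that taking the complement of [C] in the whole set of nodes
    amounts to taking its complement in L. *)
Definition mp_schur (C : {set 'I_n}) (lam : R) B : 'M[Rmin R]_n :=
  let N := (~: C)%SET in
  let laminv := rmin_fin (- lam) in
  mp_block N N B +
  mp_block N C B *m mp_star (laminv *: mp_block C C B)
    *m (laminv *: mp_block C N B).

(** ** The sequence A_1, A_2, ...

    Indices start at 1, as usual: the relevant values of [l] are 1, ..., k,
    where k satisfies [mp_last].  Beyond k all the entries are [+oo]. *)
Variable A : 'M[Rmin R]_n.

Definition mp_seq (l : nat) : 'M[Rmin R]_n :=
  iter l.-1 (fun B => mp_schur (critical_nodes B) (rmin_val (rho_min B)) B) A.

Definition mp_alpha (l : nat) : R := rmin_val (rho_min (mp_seq l)).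

(** C_l *)
Definition mp_C (l : nat) : {set 'I_n} := critical_nodes (mp_seq l).

(** C^l = C_1 U ... U C_l *)
Definition mp_Cup (l : nat) : {set 'I_n} :=
  (\bigcup_(1 <= m < l.+1) mp_C m)%SET.

(** N^l *)
Definition mp_N (l : nat) : {set 'I_n} := (~: mp_Cup l.-1)%SET.

Definition mp_last (k : nat) : Prop :=
  [/\ (0 < k)%N, mp_Cup k = [set: 'I_n]%SET &
      forall l, (0 < l < k)%N -> mp_Cup l <> [set: 'I_n]%SET].

(** The sets C_m are pairwise disjoint, hence at most one [m] can be picked. *)
Definition mp_hat (l : nat) : 'M[Rmin R]_n :=
  \matrix_(i, j)
    (rmin_fin (- (if [pick m : 'I_l | (0 < m)%N && (i \in mp_C m)] is Some m
                  then mp_alpha m else mp_alpha l)) * A i j).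

End MinPlusMatrices.

(** * Complex matrices *)
Section ComplexMatrices.
Variables (R : realType) (n : nat).
Implicit Types (s b : 'M[R[i]]_n) (C : {set 'I_n}) (G : rel 'I_n).

Definition graph_mx b G : 'M[R[i]]_n :=
  \matrix_(i, j) if G i j then b i j else 0.

Definition diag_ind C : 'M[R[i]]_n := diag_mx (\row_i (i \in C)%:R).

(** s_{CC}, its rows and columns being numbered by the enumeration of [C]. *)
Definition principal_submx C s : 'M[R[i]]_#|C| :=
  mxsub (@enum_val _ (mem C)) (@enum_val _ (mem C)) s.

(** The Schur complement is the N x N block of this matrix, N being the
    complement of [C]; the other entries vanish when s_{CC} is invertible. *)
Definition cschur C s : 'M[R[i]]_n :=
  s - colsub (@enum_val _ (mem C)) s *m invmx (principal_submx C s)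
        *m rowsub (@enum_val _ (mem C)) s.

Variables (A : 'M[Rmin R]_n) (a : 'M[R[i]]_n) (G : rel 'I_n).

(** For [l = 1] the set C^0 is empty: r^1 is the empty matrix (a unit), and
    s^1 is a^G. *)
Definition mx_r (l : nat) := principal_submx (mp_Cup A l.-1) (graph_mx a G).
Definition mx_s (l : nat) : 'M[R[i]]_n :=
  cschur (mp_Cup A l.-1) (graph_mx a G).
Definition mx_t (l : nat) := principal_submx (mp_C A l) (mx_s l).

End ComplexMatrices.

Definition simple_eigenvalue (R : realType) (m : nat) (t : 'M[R[i]]_m)
    (mu : R[i]) : Prop :=
  mup mu (char_poly t) = 1%N.

(** * Asymptotics

    Germs at 0 of functions on (0, e0) are represented by total functions on
    [R], only the values at small positive arguments being relevant. *)
Section Asymptotics.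
Variable R : realType.
Local Open Scope classical_set_scope.

Definition germ_ring (f : R -> R[i]) : Prop :=
  exists e0 k : R, [/\ 0 < e0, 0 < k,
    {within `]0, e0[, continuous (f : R -> R[i]^o)} &
    forall e, 0 < e < e0 -> `|f e| <= (e `^ (- k))%:C%C].

(** [f] is asymptotic to [b * e ^ B], for the relation written with \simeq. *)
Definition asymp (f : R -> R[i]) (b : R[i]) (B : Rmin R) : Prop :=
  match B with
  | Some r => ((e `^ (- r))%:C%C * f e : R[i]^o) @[e --> 0^'+] --> (b : R[i]^o)
  | None => \forall e \near 0^'+, f e = 0
  end.

End Asymptotics.

(* Main.v *)
Require Import Defs.
From mathcomp Require Import all_boot all_order all_algebra.
From mathcomp Require Import complex.
From mathcomp Require Import all_classical all_reals all_analysis.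
From mathcomp Require Import perm zify lra.

(** Write [d i] for the shift of row [i], so that entry [(i, j)] of the
    rescaled min-plus matrix of level [l] is [A i j - d i].  Put
    [L = x * e ^ alpha_l] in the eigenvalue equation of [Aeps e], multiply row
    [i] by [e ^ (- d i - V i)] and column [j] by [e ^ (V j)].  The coefficient
    of [(i, j)] becomes [Aeps e i j * e ^ (V j - V i - d i)]; its exponent is
    the slack of the inequality that [V] satisfies there, so the coefficient
    tends to [a i j] on the saturation graph and to [0] elsewhere.  The
    diagonal term [x * e ^ (alpha_l - d i)] tends to [x] on the rows of [N^l]
    and to [0] on the others, because the [alpha_m] increase.  Everything
    therefore reduces to the limit pencil [x E - a^Sat].

    Its determinant is computed by [level_pencil_det].  A determinant only sees
    the entries that lie on cycles of the graph ([det_eq_cycles]), and the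
    circuits of the saturation graph of level [l] are the circuits of [G] that
    stay inside [C^l] ([cycle_sat_mp_hat_last]).  After replacing one graph by
    the other, a Schur complement with pivot [r^l] ([det_pencil]) gives
    [det (- r^l)] times the characteristic polynomial of [t^l] times a power of
    [x], so that [mu] is a simple root.

    The comparison of circuits rests on finite potentials, which bound the
    weights of all circuits from below at once, equality holding exactly for
    the circuits made of tight arcs.  An irreducible matrix has one at its
    critical value ([exists_critical]); potentials lift through min-plus Schur
    complements ([schur_potential_lift]), which produces potentials of the
    rescaled matrices; and a tight arc of a Schur complement unfolds into a
    tight walk ([schur_tight]), which gives the strict growth of the [alpha_l]
    ([mp_alpha_lt]).

    For the analytic part, a simple root of the limit polynomial is the limit
    of exactly one root of the approximating polynomials ([tends_root],
    [tends_root_unique]).  At a simple root the adjugate of the pencil does not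
    vanish ([adj_neq0_simple_root]), and every kernel vector is proportional to
    each nonzero column of the adjugate ([adj_kernel_proportional]).  This
    gives the uniqueness of [w], and, as adjugates are continuous, also the
    limits of the ratios of coordinates of the eigenvectors. *)

Set Implicit Arguments.
Unset Strict Implicit.
Unset Printing Implicit Defensive.

Import Order.TTheory GRing.Theory Num.Theory.
Import numFieldNormedType.Exports.

Local Open Scope ring_scope.

(** * Order and infima in the min-plus semiring *)
Section RminOrder.
Variable R : realType.
Implicit Types (x y z : Rmin R) (S : set (Rmin R)).

Definition rmin_le x y : bool :=
  match y with
  | None => true
  | Some b => if x is Some a then a <= b else false
  end.

Lemma rmin_leE x y : rmin_le x y = (rmin_to_ereal x <= rmin_to_ereal y)%E.
Proof.
by case: x y => [a|] [b|] //=; rewrite ?lee_fin ?leey // leye_eq.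
Qed.

Lemma rmin_le_refl x : rmin_le x x.
Proof. by rewrite rmin_leE. Qed.

Lemma rmin_le_trans y x z : rmin_le x y -> rmin_le y z -> rmin_le x z.
Proof. by rewrite !rmin_leE; exact: le_trans. Qed.

Lemma rmin_le_anti x y : rmin_le x y -> rmin_le y x -> x = y.
Proof.
case: x y => [a|] [b|] //= ab ba.
by congr Some; apply/eqP; rewrite eq_le ab ba.
Qed.

Lemma rmin_le_add z x y : rmin_le z (x + y) = rmin_le z x && rmin_le z y.
Proof.
case: x y z => [a|] [b|] [c|] //=; rewrite ?andbT //=.
by rewrite /GRing.add /= le_min.
Qed.

Lemma rmin_le_mul x x' y y' :
  rmin_le x y -> rmin_le x' y' -> rmin_le (x * x') (y * y').
Proof.
by case: y => [b|]; case: y' => [b'|]; case: x => [a|]; case: x' => [a'|] //=;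
  exact: lerD.
Qed.

Lemma rmin_le_sum (I : finType) z (F : I -> Rmin R) :
  (forall i, rmin_le z (F i)) -> rmin_le z (\sum_i F i).
Proof. by move=> zF; elim/big_ind: _ => // x y; rewrite rmin_le_add => -> ->. Qed.

Lemma rmin_sum_le (I : finType) (F : I -> Rmin R) i :
  rmin_le (\sum_i F i) (F i).
Proof.
have := rmin_le_refl (\sum_i F i).
by rewrite {2}(bigD1 i) //= rmin_le_add => /andP[].
Qed.

Lemma rmin_sum_attained (I : finType) (F : I -> Rmin R) v :
  \sum_i F i = Some v -> exists i, F i = Some v.
Proof.
elim/big_rec: _ => [//|i x _ IH].
case Fi: (F i) => [a|]; case: x IH => [b|] IH //= [].
- rewrite /GRing.add /= /Num.min; case: ifP => _ xv; first by exists i; rewrite Fi xv.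
  by apply: IH; rewrite xv.
- by move=> av; exists i; rewrite Fi av.
Qed.

Lemma rmin_inf_ereal S m : (forall y, S y -> rmin_le (Some m) y) ->
  rmin_to_ereal (rmin_inf S) = ereal_inf ((@rmin_to_ereal R @` S)%classic).
Proof.
move=> Sm; rewrite /rmin_inf.
have : (m%:E <= ereal_inf ((@rmin_to_ereal R @` S)%classic))%E.
  by apply: le_ereal_inf_tmp => _ [y /Sm + <-]; rewrite rmin_leE.
by case: ereal_inf.
Qed.

Lemma rmin_inf_le S m x : (forall y, S y -> rmin_le (Some m) y) -> S x ->
  rmin_le (rmin_inf S) x.
Proof.
move=> Sm Sx; rewrite rmin_leE (rmin_inf_ereal Sm).
by apply: ereal_inf_lbound; exists x.
Qed.

Lemma rmin_inf_ge S m z : (forall y, S y -> rmin_le (Some m) y) ->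
  (forall y, S y -> rmin_le z y) -> rmin_le z (rmin_inf S).
Proof.
move=> Sm Sz; rewrite rmin_leE (rmin_inf_ereal Sm).
by apply: le_ereal_inf_tmp => _ [y /Sz + <-]; rewrite rmin_leE.
Qed.

Lemma rmin_inf_min S m :
  S (Some m) -> (forall y, S y -> rmin_le (Some m) y) -> rmin_inf S = Some m.
Proof.
move=> mS Sm; apply: rmin_le_anti; first exact: (rmin_inf_le Sm mS).
exact: (rmin_inf_ge Sm Sm).
Qed.

Lemma rmin_inf_approx S m v d : (forall y, S y -> rmin_le (Some m) y) ->
  rmin_inf S = Some v -> 0 < d -> exists2 b, S (Some b) & b < v + d.
Proof.
move=> Sm Sv d0; apply: contrapT => nS.
have : rmin_le (Some (v + d)) (rmin_inf S).
  apply: (rmin_inf_ge Sm) => -[b|//] Sb /=; rewrite leNgt; apply/negP => bv.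
  by apply: nS; exists b.
by rewrite Sv /=; lra.
Qed.

End RminOrder.

(** * Circuits, walks and potentials *)
Section Walks.
Variables (R : realType) (n : nat).
Implicit Types (B : 'M[Rmin R]_n) (d U : 'I_n -> R) (c p : seq 'I_n).

Fixpoint walk_weight B x p : R :=
  if p is y :: q then rmin_val (B x y) + walk_weight B y q else 0.

Lemma walk_weight_cat B x p q :
  walk_weight B x (p ++ q) = walk_weight B x p + walk_weight B (last x p) q.
Proof. by elim: p x => [|y p IH] x /=; rewrite ?add0r // IH addrA. Qed.

Lemma walk_weight_rcons B x p y :
  walk_weight B x (rcons p y) =
  \sum_(e <- zip (x :: p) (rcons p y)) rmin_val (B e.1 e.2).
Proof. by elim: p x => [|z p IH] x /=; rewrite big_cons ?big_nil //= IH. Qed.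

Lemma circuit_weight_walk B x p :
  circuit_weight B (x :: p) = walk_weight B x (rcons p x).
Proof. by rewrite walk_weight_rcons /circuit_weight /circuit_arcs rot1_cons. Qed.

Lemma path_rcons_arcs (e : rel 'I_n) x p y : path e x (rcons p y) =
  all (fun a => e a.1 a.2) (zip (x :: p) (rcons p y)).
Proof. by elim: p x => [|z p IH] x //=; rewrite IH. Qed.

Lemma cycle_arcs (e : rel 'I_n) c :
  cycle e c = all (fun a => e a.1 a.2) (circuit_arcs c).
Proof.
by case: c => [//|x c]; rewrite /circuit_arcs rot1_cons /= path_rcons_arcs.
Qed.

Lemma mem_circuit_arcs c i j : (i, j) \in circuit_arcs c -> i \in c.
Proof.
move=> ijc; have -> : c = unzip1 (circuit_arcs c).
  by rewrite unzip1_zip // size_rot.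
by apply/mapP; exists (i, j).
Qed.

Lemma exists_circuit_arc c i :
  i \in c -> exists j, (i, j) \in circuit_arcs c.
Proof.
have {1}-> : c = unzip1 (circuit_arcs c) by rewrite unzip1_zip // size_rot.
by case/mapP=> -[x y] xyc /= ->; exists y.
Qed.

(** Every node of a circuit is left once and entered once, so differences of
    potentials cancel along it. *)
Lemma circuit_sum_potential d U c :
  \sum_(a <- circuit_arcs c) (d a.1 + U a.1 - U a.2) = \sum_(i <- c) d i.
Proof.
have sz : size (rot 1 c) = size c by rewrite size_rot.
have sum1 (F : 'I_n -> R) : \sum_(a <- circuit_arcs c) F a.1 = \sum_(i <- c) F i.
  by rewrite -[in RHS](@unzip1_zip _ _ c (rot 1 c)) ?sz // /unzip1 big_map.
have sum2 : \sum_(a <- circuit_arcs c) U a.2 = \sum_(i <- c) U i.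
  transitivity (\sum_(i <- rot 1 c) U i); last first.
    by apply: perm_big; rewrite perm_rot.
  by rewrite -[in RHS](@unzip2_zip _ _ c (rot 1 c)) ?sz // /unzip2 big_map.
by rewrite sumrB big_split /= !sum1 sum2 addrK.
Qed.

(** [U] is a subsolution of the spectral problem in which row [i] carries its
    own shift [d i]; it plays the role of a dual certificate: it bounds from
    below the weights of all the circuits at once. *)
Definition potential B d U : Prop :=
  forall i j b, B i j = Some b -> d i + U i <= b + U j.

Definition tight B d U : rel 'I_n :=
  fun i j => B i j == Some (d i + U i - U j).

Lemma tight_arc B d U i j : tight B d U i j -> mp_arc B i j.
Proof. by rewrite /mp_arc => /eqP->. Qed.

Lemma circuit_tight B d U c :
  c != [::] -> cycle (tight B d U) c ->
  circuit B c /\ circuit_weight B c = \sum_(i <- c) d i.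
Proof.
move=> c0 cc; split.
  by split=> //; apply: sub_cycle cc => i j; exact: tight_arc.
rewrite -(circuit_sum_potential d U) /circuit_weight.
move: cc; rewrite cycle_arcs => /allP cc.
by apply: eq_big_seq => a /cc /eqP ->.
Qed.

Lemma circuit_weight_ge B d U c : potential B d U -> circuit B c ->
  \sum_(i <- c) d i <= circuit_weight B c.
Proof.
move=> pU [_]; rewrite cycle_arcs => /allP cc.
rewrite -(circuit_sum_potential d U) /circuit_weight.
rewrite [leLHS]big_seq_cond [leRHS]big_seq_cond.
apply: ler_sum => -[i j]; rewrite andbT => /cc.
by rewrite /mp_arc /=; case Bij: (B i j) => [b|//] _ /=; have := pU _ _ _ Bij; lra.
Qed.

Lemma circuit_weight_eq B d U c : potential B d U -> circuit B c ->
  circuit_weight B c = \sum_(i <- c) d i -> cycle (tight B d U) c.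
Proof.
move=> pU [_]; rewrite !cycle_arcs => cc.
rewrite -(circuit_sum_potential d U) /circuit_weight.
elim: (circuit_arcs c) cc => [//|[i j] s IH] /= /andP[+ cc].
rewrite !big_cons /= /mp_arc; case Bij: (B i j) => [b|//] _ /= eqs.
have ge1 := pU _ _ _ Bij.
have ge2 : \sum_(a <- s) (d a.1 + U a.1 - U a.2) <=
           \sum_(a <- s) rmin_val (B a.1 a.2).
  rewrite [leLHS]big_seq_cond [leRHS]big_seq_cond.
  move/allP: cc => cc; apply: ler_sum => -[x y]; rewrite andbT => /cc.
  by rewrite /mp_arc /=; case Bxy: (B x y) => [v|//] _ /=;
     have := pU _ _ _ Bxy; lra.
rewrite IH ?andbT //; last by lra.
by rewrite /tight Bij; apply/eqP; congr Some; lra.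
Qed.

Lemma circuit_mean_le B c lam : c != [::] ->
  (lam <= circuit_mean B c) = (\sum_(i <- c) lam <= circuit_weight B c).
Proof.
move=> c0; rewrite /circuit_mean ler_pdivlMr.
  by rewrite big_const_seq count_predT iter_addr addr0 mulr_natr.
by rewrite ltr0n lt0n size_eq0.
Qed.

Lemma circuit_mean_eq B c lam : c != [::] ->
  (circuit_mean B c == lam) = (circuit_weight B c == \sum_(i <- c) lam).
Proof.
move=> c0; rewrite /circuit_mean -[X in _ == X]divr1.
rewrite eqr_div ?oner_eq0 ?pnatr_eq0 ?size_eq0 // mulr1.
by rewrite big_const_seq count_predT iter_addr addr0 mulr_natr.
Qed.

Lemma rho_min_potential B lam U c : potential B (fun=> lam) U ->
  circuit B c -> circuit_weight B c = \sum_(i <- c) lam ->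
  rho_min B = Some lam.
Proof.
move=> pU cc wc; have [c0 _] := cc.
apply: rmin_inf_min.
  by exists c => //; congr Some; apply/eqP; rewrite circuit_mean_eq ?wc.
move=> _ [c' cc' <-] /=; have [c0' _] := cc'.
by rewrite circuit_mean_le //; exact: (circuit_weight_ge pU cc').
Qed.

Lemma critical_circuitP B lam U c : potential B (fun=> lam) U ->
  rho_min B = Some lam ->
  critical_circuit B c <-> c != [::] /\ cycle (tight B (fun=> lam) U) c.
Proof.
move=> pU rB; split.
  move=> [cc]; have [c0 _] := cc; rewrite rB => -[/eqP].
  by rewrite circuit_mean_eq // => /eqP wc; split=> //; apply: circuit_weight_eq.
move=> [c0 ct]; have [cc wc] := circuit_tight c0 ct.
by split=> //; rewrite rB; congr Some; apply/eqP; rewrite circuit_mean_eq // wc.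
Qed.

Lemma circuit_of_arc (e : rel 'I_n) i j :
  e i j -> connect e j i -> exists2 c, cycle e c & (i, j) \in circuit_arcs c.
Proof.
move=> eij /connectP[p pp ip].
have jp : j :: p = rcons (belast j p) i by rewrite lastI -ip.
exists (i :: belast j p); first by rewrite /= -jp /= eij.
by rewrite /circuit_arcs rot1_cons -jp /= mem_head.
Qed.

End Walks.

(** * Existence of a critical circuit and of a potential *)

(** Strong connectivity by walks with at least one arc, which also asks for a
    loop when there is a single node. *)
Definition linked (T : finType) (e : rel T) : rel T :=
  fun i j => [exists k, e i k && connect e k j].

Lemma linkedP (T : finType) (e : rel T) i j :
  reflect (exists k, e i k /\ connect e k j) (linked e i j).
Proof.
apply: (iffP existsP) => -[k] => [/andP[ik kj]|[ik kj]]; exists k => //.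
exact/andP.
Qed.

Lemma nonuniq_split (T : eqType) (s : seq T) : ~~ uniq s ->
  exists p1 y p2 p3, s = p1 ++ y :: p2 ++ y :: p3.
Proof.
elim: s => [//|x s IH] /=; rewrite negb_and negbK => /orP[xs|/IH].
  by case/splitPr: xs => p2 p3; exists [::], x, p2, p3.
by move=> [p1 [y [p2 [p3 ->]]]]; exists (x :: p1), y, p2, p3.
Qed.

Section CriticalCircuit.
Variables (R : realType) (n : nat) (B : 'M[Rmin R]_n).

(** A closed walk longer than the number of nodes visits some node twice, and
    splits there into two shorter closed walks. *)
Lemma closed_walk_weight_ge (lam : R) N : (n <= N)%N ->
  (forall x p, path (mp_arc B) x p -> last x p = x -> (size p <= N)%N ->
     lam *+ size p <= walk_weight B x p) ->
  forall x p, path (mp_arc B) x p -> last x p = x ->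
    lam *+ size p <= walk_weight B x p.
Proof.
move=> nN short x p; have [m] := ubnP (size p).
elim: m => // m IH in x p *; rewrite ltnS => szp pp lp.
have [/short|Nszp] := leqP (size p) N; first exact.
have /nonuniq_split[p1 [y [p2 [p3 Dp]]]] : ~~ uniq p.
  apply/negP => /card_uniqP up; have := max_card (mem p).
  by rewrite up card_ord leqNgt (leq_ltn_trans nN).
move: pp lp szp; rewrite {}Dp {Nszp p}.
rewrite cat_path /= cat_path /= last_cat /= last_cat /=.
case/and5P=> pp1 e1 pp2 e2 pp3 lp szp.
have := IH y (rcons p2 y); have := IH x (p1 ++ y :: p3).
rewrite rcons_path cat_path last_cat /= last_rcons lp pp1 e1 pp2 e2 pp3.
rewrite !size_cat /= !size_cat /= size_rcons in szp *.
move=> /(_ _ isT erefl) h1 /(_ _ isT erefl) h2.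
have {}h1 : lam *+ (size p1 + (size p3).+1) <= walk_weight B x (p1 ++ y :: p3).
  by apply: h1; lia.
have {}h2 : lam *+ (size p2).+1 <= walk_weight B y (rcons p2 y).
  by apply: h2; lia.
move: h1 h2; rewrite -cats1 !walk_weight_cat /= !walk_weight_cat /= addr0.
rewrite (_ : (_ + (_ + _).+1)%N = (size p1 + (size p3).+1 + (size p2).+1)%N).
  by rewrite !mulrnDr; lra.
rewrite -addnA; congr (_ + _)%N.
by rewrite addSn !addnS [(size p3 + _)%N]addnC.
Qed.

Variable L : {set 'I_n}.
Hypothesis L_neq0 : L != finset.set0.
Hypothesis B_supp : forall i j, mp_arc B i j -> i \in L /\ j \in L.
Hypothesis B_linked : {in L &, forall i j, linked (mp_arc B) i j}.

(** The infimum of the circuit means is a minimum: only the finitely many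
    circuits below some length need to be compared. *)
Lemma exists_min_circuit : exists2 c, circuit B c &
  forall x p, path (mp_arc B) x p -> last x p = x ->
    circuit_mean B c *+ size p <= walk_weight B x p.
Proof.
have [i0 i0L] := set0Pn _ L_neq0.
have [k [i0k ki0]] := linkedP _ _ _ (B_linked i0L i0L).
have [c0 cc0 ic0] := circuit_of_arc i0k ki0.
(* The bound also covers the circuit [c0], so that the minimum is taken over a
   nonempty set. *)
pose N := maxn n (size c0).
have szc0 : (size c0 <= N)%N by rewrite leq_maxr.
pose good (c : N.-bseq 'I_n) := (c != [::] :> seq _) && cycle (mp_arc B) c.
have good0 : good (Bseq szc0) by rewrite /good /= cc0 andbT; case: (c0) ic0.
case: (@arg_minP _ _ _ (Bseq szc0) good (fun c => circuit_mean B c) good0).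
move=> c /andP[cn0 cc] cmin; exists c => //.
apply: (@closed_walk_weight_ge _ N); first by rewrite leq_maxl.
move=> x p; case/lastP: p => [|p y] pp; first by rewrite mulr0n.
rewrite last_rcons => yx szp; move: yx szp pp => -> szp pp.
have szq : (size (x :: p) <= N)%N by move: szp; rewrite size_rcons.
have := cmin (Bseq szq); rewrite /good /= pp => /(_ isT).
by rewrite circuit_mean_le // circuit_weight_walk big_const_seq count_predT
  iter_addr addr0 size_rcons.
Qed.

(** The potential of a node is the infimum of the weights, diminished by [lam]
    per arc, of the walks from it to a fixed node [x0].  It is finite since a
    walk followed by a return walk from [x0] is closed, hence has a nonnegative
    diminished weight. *)
Lemma exists_critical : exists lam U c,
  [/\ potential B (fun=> lam) U, critical_circuit B c & rho_min B = Some lam].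
Proof.
have [c cc cmin] := exists_min_circuit; set lam := circuit_mean B c in cmin.
have [x0 x0L] := set0Pn _ L_neq0.
pose S i : set R := [set walk_weight B i p - lam *+ size p | p in
  [set p | path (mp_arc B) i p && (last i p == x0)]]%classic.
pose U i := inf (S i).
have conn i : i \in L -> connect (mp_arc B) i x0 /\ connect (mp_arc B) x0 i.
  move=> iL; split.
    have [k [e h]] := linkedP _ _ _ (B_linked iL x0L).
    exact: connect_trans (connect1 e) h.
  have [k [e h]] := linkedP _ _ _ (B_linked x0L iL).
  exact: connect_trans (connect1 e) h.
have Slb i : i \in L -> has_lbound (S i).
  move=> iL; have [_ /connectP[q pq iq]] := conn _ iL.
  exists (lam *+ size q - walk_weight B x0 q).
  move=> _ [p /= /andP[pp /eqP lp] <-].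
  have := cmin x0 (q ++ p); rewrite cat_path last_cat -iq pp pq lp.
  move=> /(_ isT erefl); rewrite walk_weight_cat size_cat mulrnDr -iq.
  by rewrite lerBlDr; lra.
have pU : potential B (fun=> lam) U.
  move=> i j b Eb; have eij : mp_arc B i j by rewrite /mp_arc Eb.
  have [iL jL] := B_supp eij.
  rewrite addrC -lerBrDr addrAC -lerBlDl.
  apply: lb_le_inf.
    have [/connectP[q pq jq] _] := conn _ jL.
    by exists (walk_weight B j q - lam *+ size q); exists q => //=; rewrite pq jq eqxx.
  move=> _ [p /= /andP[pp lp] <-].
  have : U i <= walk_weight B i (j :: p) - lam *+ size (j :: p).
    by apply: (ge_inf (Slb _ iL)); exists (j :: p) => //=; rewrite eij pp.
  by rewrite /= Eb /= mulrS; lra.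
have [c0 _] := cc.
have wc : circuit_weight B c = \sum_(i <- c) lam.
  by apply/eqP; rewrite -circuit_mean_eq.
exists lam, U, c; have rB := rho_min_potential pU cc wc.
by split=> //; split=> //; rewrite rB.
Qed.
End CriticalCircuit.

(** * Kleene star and min-plus Schur complements *)
Section Star.
Variables (R : realType) (n : nat) (X : 'M[Rmin R]_n) (U : 'I_n -> R).
Hypothesis X_ge : forall i j, rmin_le (Some (U i - U j)) (X i j).

Lemma mp_pow_ge m i j : rmin_le (Some (U i - U j)) ((X ^+ m) i j).
Proof.
elim: m i j => [|m IH] i j.
  rewrite expr0 mxE; case: eqP => [->|_] //=; first by rewrite subrr.
rewrite exprS -mulmxE mxE; apply: rmin_le_sum => k.
have := rmin_le_mul (X_ge i k) (IH k j).
by rewrite /GRing.mul /= addrA subrK.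
Qed.

Lemma mp_star_lb i j :
  forall y, [set (X ^+ m) i j | m in [set: nat]]%classic y ->
  rmin_le (Some (U i - U j)) y.
Proof. by move=> _ [m _ <-]; exact: mp_pow_ge. Qed.

Lemma mp_star_ge i j : rmin_le (Some (U i - U j)) (mp_star X i j).
Proof. by rewrite mxE; apply: rmin_inf_ge; exact: mp_star_lb. Qed.

Lemma mp_star_le m i j : rmin_le (mp_star X i j) ((X ^+ m) i j).
Proof. by rewrite mxE; apply: (rmin_inf_le (@mp_star_lb i j)); exists m. Qed.

Lemma mp_star_diag i : rmin_le (mp_star X i i) (Some 0).
Proof. by have := mp_star_le 0 i i; rewrite expr0 [in X in rmin_le _ X]mxE eqxx. Qed.

(** Prolonging a walk on the left.  As the star is an infimum that may not be
    attained, the weight of the first arc is moved to the other side before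
    the infimum is taken over the rest of the walk. *)
Lemma mp_star_step i j k :
  rmin_le (mp_star X i k) (X i j * mp_star X j k).
Proof.
case Xij: (X i j) => [x|//].
have -> : mp_star X i k = rmin_fin x * (rmin_fin (- x) * mp_star X i k).
  by rewrite mulrA; case: (mp_star X i k) => [s|//]; congr Some; rewrite subrr add0r.
apply: rmin_le_mul => //; first by rewrite rmin_le_refl.
rewrite [mp_star X j k]mxE; apply: (rmin_inf_ge (@mp_star_lb j k)) => _ [m _ <-].
have le1 : rmin_le (mp_star X i k) (rmin_fin x * (X ^+ m) j k).
  apply: rmin_le_trans (mp_star_le m.+1 i k) _.
  by rewrite exprS -mulmxE mxE /rmin_fin -Xij; exact: (rmin_sum_le _ j).
apply: rmin_le_trans (rmin_le_mul (rmin_le_refl (rmin_fin (- x))) le1) _.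
case: ((X ^+ m) j k) => [y|//] /=.
by rewrite addrA addNr add0r.
Qed.

(** The slacks of the entries of [X] take finitely many values; a walk whose
    slack is below all the positive ones has no slack at all. *)
Lemma mp_star_tight i j : mp_star X i j = Some (U i - U j) ->
  connect (fun k l => X k l == Some (U k - U l)) i j.
Proof.
set T := (fun k l => _) => Sij.
pose slack (e : 'I_n * 'I_n) := rmin_val (X e.1 e.2) - (U e.1 - U e.2).
pose r := \big[Num.min/1]_(e | 0 < slack e) slack e.
have r_gt0 : 0 < r by rewrite /r; elim/big_ind: _ => // a b a0 b0; rewrite lt_min a0.
have r_le k l : 0 < slack (k, l) -> r <= slack (k, l).
  by move=> s0; rewrite /r (bigD1 (k, l)) //= ge_min lexx.
have powT m : forall i j b, (X ^+ m) i j = Some b -> b < U i - U j + r ->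
    connect T i j.
  elim: m => [|m IH] {Sij i j} i j b.
    by rewrite expr0 mxE; case: eqP => [->|].
  rewrite exprS -mulmxE mxE => /rmin_sum_attained[k].
  case Xik: (X i k) => [x|//]; case Pkj: ((X ^+ m) k j) => [y|//] [<-] lt_b.
  have := X_ge i k; rewrite Xik /= => ge_x.
  have := mp_pow_ge m k j; rewrite Pkj /= => ge_y.
  have xE : x = U i - U k.
    apply/eqP; rewrite eq_le ge_x andbT leNgt; apply/negP => gt_x.
    have := r_le i k; rewrite /slack /= Xik /= => /(_ ltac:(lra)).
    by lra.
  apply: connect_trans (IH k j y Pkj ltac:(lra)); apply: connect1.
  by rewrite /T Xik xE.
move: Sij; rewrite mxE => /(rmin_inf_approx (@mp_star_lb i j))/(_ r_gt0).
by case=> b [m _ Eb] lt_b; exact: powT Eb lt_b.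
Qed.

End Star.

Section Schur.
Variables (R : realType) (n : nat) (B : 'M[Rmin R]_n) (C : {set 'I_n}).
Variables (lam : R) (U : 'I_n -> R).
Hypothesis BU : potential B (fun=> lam) U.

Let X : 'M[Rmin R]_n := rmin_fin (- lam) *: mp_block C C B.
Let B' : 'M[Rmin R]_n := mp_schur C lam B.

Lemma shifted_blockE i j :
  X i j = if (i \in C) && (j \in C) then rmin_fin (- lam) * B i j else None.
Proof. by rewrite !mxE; case: ifP. Qed.

Lemma potential_le i j : rmin_le (Some (lam + U i - U j)) (B i j).
Proof. by case Eb: (B i j) => [b|//] /=; have := BU Eb; lra. Qed.

Lemma shifted_block_ge i j : rmin_le (Some (U i - U j)) (X i j).
Proof.
rewrite shifted_blockE; case: ifP => // _.
have := rmin_le_mul (rmin_le_refl (rmin_fin (- lam))) (potential_le i j).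
by rewrite /GRing.mul /= => /(rmin_le_trans _); apply => /=; lra.
Qed.

Lemma schurE i j : i \notin C -> j \notin C -> B' i j = B i j +
  \sum_l (\sum_k (if k \in C then B i k else None) * mp_star X k l) *
         (if l \in C then rmin_fin (- lam) * B l j else None).
Proof.
move=> iC jC; rewrite /B' /mp_schur mxE mxE !inE iC jC /=; congr (_ + _).
rewrite mxE; apply: eq_bigr => l _; congr (_ * _).
  by rewrite mxE; apply: eq_bigr => k _; rewrite !mxE !inE iC.
by rewrite !mxE !inE jC andbT; case: ifP.
Qed.

(** A finite entry of the Schur complement is the weight of an arc or of a
    detour through [C], the minimum of finitely many terms being one of them;
    the detour inside [C] itself is only known through its star. *)
Lemma schur_attained i j v : B' i j = Some v ->
  [/\ i \notin C, j \notin C & B i j = Some v \/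
     exists k l x s y, [/\ k \in C, l \in C & [/\ B i k = Some x,
       mp_star X k l = Some s, B l j = Some y & v = x + s + (y - lam)]]].
Proof.
have [iC|iC] := boolP (i \in C).
  rewrite /B' /mp_schur mxE mxE !inE iC /= add0r mxE => /rmin_sum_attained[l].
  rewrite mxE (_ : \sum_j _ = 0) ?mul0r //.
  by rewrite big1 // => k _; rewrite !mxE !inE iC mul0r.
have [jC|jC] := boolP (j \in C).
  rewrite /B' /mp_schur mxE mxE !inE jC andbF /= add0r mxE.
  by case/rmin_sum_attained => l; rewrite !mxE !inE jC andbF mulr0.
rewrite schurE // => Ev; split=> //; move: Ev.
set S := \sum_l _.
have : S = Some v -> exists k l x s y, [/\ k \in C, l \in C &
    [/\ B i k = Some x, mp_star X k l = Some s, B l j = Some y &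
       v = x + s + (y - lam)]].
  case/rmin_sum_attained => l.
  case Sl: (\sum_k _) => [z|//]; case: ifP => // lC.
  case Elj: (B l j) => [y|//] [Ev].
  have [k] := rmin_sum_attained Sl; case: ifP => // kC.
  case Eik: (B i k) => [x|//]; case Ekl: (mp_star X k l) => [s|//] [Ez].
  by exists k, l, x, s, y; split=> //; split=> //; rewrite -Ev -Ez; lra.
case: S => [z|]; case: (B i j) => [b|] //= Sz.
- rewrite /GRing.add /= /Num.min; case: ifP => _ [Ev]; first by left; rewrite Ev.
  by right; apply: Sz; rewrite Ev.
- by case=> Ev; right; apply: Sz; rewrite Ev.
- by left.
Qed.

Lemma schur_le_direct i j : i \notin C -> j \notin C ->
  rmin_le (B' i j) (B i j).
Proof.
move=> iC jC; have := rmin_le_refl (B' i j).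
by rewrite {2}schurE // rmin_le_add => /andP[].
Qed.

Lemma schur_le_path i j k l :
  i \notin C -> j \notin C -> k \in C -> l \in C ->
  rmin_le (B' i j) (B i k * mp_star X k l * (rmin_fin (- lam) * B l j)).
Proof.
move=> iC jC kC lC; have := rmin_le_refl (B' i j).
rewrite {2}schurE // rmin_le_add => /andP[_] /rmin_le_trans; apply.
apply: rmin_le_trans (rmin_sum_le _ l) _; rewrite lC.
apply: rmin_le_mul; last exact: rmin_le_refl.
by apply: rmin_le_trans (rmin_sum_le _ k) _; rewrite kC rmin_le_refl.
Qed.

Lemma schur_potential : potential B' (fun=> lam) U.
Proof.
move=> i j v /schur_attained[iC jC [/BU //|]].
move=> [k [l [x [s [y [kC lC [Ex Es Ey ->]]]]]]].
have := BU Ex; have := BU Ey.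
by have := mp_star_ge shifted_block_ge k l; rewrite Es /=; lra.
Qed.

(** When no slack is left on the Schur complement, none is left on the detour
    through [C], whose star part then comes from an actual tight walk. *)
Lemma schur_tight i j :
  tight B' (fun=> lam) U i j -> linked (tight B (fun=> lam) U) i j.
Proof.
move=> /eqP/schur_attained[iC jC [Eb|]].
  by apply/linkedP; exists j; rewrite /tight Eb eqxx.
move=> [k [l [x [s [y [kC lC [Ex Es Ey Ev]]]]]]].
have ge_x := BU Ex; have ge_y := BU Ey.
have := mp_star_ge shifted_block_ge k l; rewrite Es /= => ge_s.
have Es' : mp_star X k l = Some (U k - U l) by rewrite Es; congr Some; lra.
have {Es'} := mp_star_tight shifted_block_ge Es'.
move=> /(connect_sub (e' := tight B (fun=> lam) U)) kl.
apply/linkedP; exists k; split; first by rewrite /tight Ex; apply/eqP; congr Some; lra.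
apply: (@connect_trans _ _ l).
  apply: kl => p q /eqP; rewrite shifted_blockE; case: ifP => // _.
  case Epq: (B p q) => [b|//] [Eb]; apply: connect1.
  by rewrite /tight Epq; apply/eqP; congr Some; lra.
by apply: connect1; rewrite /tight Ey; apply/eqP; congr Some; lra.
Qed.

Variable L : {set 'I_n}.
Hypothesis B_supp : forall i j, mp_arc B i j -> i \in L /\ j \in L.
Hypothesis B_linked : {in L &, forall i j, linked (mp_arc B) i j}.

Lemma schur_supp i j : mp_arc B' i j -> i \in L :\: C /\ j \in L :\: C.
Proof.
rewrite /mp_arc; case Ev: (B' i j) => [v|//] _.
have arc p q b : B p q = Some b -> p \in L /\ q \in L.
  by move=> Eb; apply: B_supp; rewrite /mp_arc Eb.
have [iC jC [/arc[iL jL]|]] := schur_attained Ev; rewrite !inE iC jC //.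
by move=> [k [l [x [s [y [_ _ [/arc[iL _] _ /arc[_ jL] _]]]]]]].
Qed.

Let star_fin i : mp_star X i i != None.
Proof. by have := mp_star_diag shifted_block_ge i; case: (mp_star X i i). Qed.

(** Read from its end, a walk of [B] projects to a walk of the Schur complement;
    when it starts inside [C], one has to remember the place [l] where it
    leaves [C], because the arc that enters [C] is not known yet. *)
Lemma schur_walk x p j : path (mp_arc B) x p -> last x p = j -> j \notin C ->
  if x \in C then exists y l, [/\ y \notin C, l \in C,
      mp_star X x l != None, mp_arc B l y & connect (mp_arc B') y j]
  else connect (mp_arc B') x j.
Proof.
move=> pp lp jC; elim: p x pp lp => [|y p IH] x /=.
  by move=> _ ->; rewrite (negPf jC).
case/andP=> xy /IH{}IH /IH{IH}; case: ifPn => [yC|yC].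
  move=> [z [l [zC lC yl lz zj]]]; case: ifPn => xC.
    exists z, l; split=> //; have := mp_star_step shifted_block_ge x y l.
    rewrite shifted_blockE xC yC /=; move: xy yl; rewrite /mp_arc.
    case: (B x y) => [b|//] _; case: (mp_star X y l) => [s|//] _.
    by case: (mp_star X x l).
  apply: connect_trans zj; apply: connect1.
  have := schur_le_path xC zC yC lC; move: xy yl lz; rewrite /mp_arc.
  case: (B x y) => [b|//] _; case: (mp_star X y l) => [s|//] _.
  by case: (B l z) => [b'|//] _; case: (B' x z).
move=> yj; case: ifPn => xC; first by exists y, x.
apply: connect_trans yj; apply: connect1.
have := schur_le_direct xC yC; move: xy; rewrite /mp_arc.
by case: (B x y) => [b|//] _; case: (B' x y).
Qed.

Lemma schur_linked : {in L :\: C &, forall i j, linked (mp_arc B') i j}.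
Proof.
move=> i j; rewrite !inE => /andP[iC iL] /andP[jC jL].
have /linkedP[k [ik /connectP[p pp /esym lp]]] := B_linked iL jL.
apply/linkedP; have := schur_walk pp lp jC; case: ifPn => [kC|kC].
  move=> [y [l [yC lC kl ly yj]]]; exists y; split=> //.
  have := schur_le_path iC yC kC lC; move: ik kl ly; rewrite /mp_arc.
  case: (B i k) => [b|//] _; case: (mp_star X k l) => [s|//] _.
  by case: (B l y) => [b'|//] _; case: (B' i y).
move=> kj; exists k; split=> //.
have := schur_le_direct iC kC; move: ik; rewrite /mp_arc.
by case: (B i k) => [b|//] _; case: (B' i k).
Qed.

(** A potential of the Schur complement extends to the eliminated nodes by
    propagating it backwards along the walks inside [C]. *)
Lemma schur_potential_lift d W : C \subset L -> L :\: C != finset.set0 ->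
  potential B' d W ->
  exists W', potential B (fun i => if i \in C then lam else d i) W'.
Proof.
move=> CL /set0Pn[j0]; rewrite inE => /andP[j0C j0L] B'W.
(* Coordinate [i] of [w] is the least cost of leaving [C] from [i], followed by
   the potential of the node that is reached. *)
pose w : 'cV[Rmin R]_n :=
  mp_star X *m (\matrix_(i, j) (if (i \in C) && (j \notin C)
                               then rmin_fin (- lam) * B i j else None))
    *m (\col_j rmin_fin (W j)).
have wE i : w i 0 = \sum_j (\sum_l mp_star X i l *
    (if (l \in C) && (j \notin C) then rmin_fin (- lam) * B l j else None)) *
    rmin_fin (W j).
  rewrite mxE; apply: eq_bigr => j _; rewrite mxE [in RHS]/=; congr (_ * _).
    by apply: eq_bigr => l _; rewrite mxE.
  by rewrite mxE.
have w_le i j l : l \in C -> j \notin C -> rmin_le (w i 0)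
    (mp_star X i l * (rmin_fin (- lam) * B l j) * rmin_fin (W j)).
  move=> lC jC; rewrite wE; apply: rmin_le_trans (rmin_sum_le _ j) _.
  apply: rmin_le_mul (rmin_le_refl _).
  by apply: rmin_le_trans (rmin_sum_le _ l) _; rewrite lC jC rmin_le_refl.
have w_fin i : i \in C -> w i 0 != None.
  move=> iC; have iL := fintype.subsetP CL _ iC.
  have /linkedP[k [ik kj]] := B_linked iL j0L.
  have /connectP[p pp /esym lp] := connect_trans (connect1 ik) kj.
  have := schur_walk pp lp j0C; rewrite iC => -[y [l [yC lC il ly _]]].
  have := w_le i y l lC yC; move: il ly; rewrite /mp_arc.
  case: (mp_star X i l) => [s|//] _; case: (B l y) => [b|//] _.
  by case: (w i 0).
have w_step i j : rmin_le (w i 0) (X i j * w j 0).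
  rewrite [w j 0]wE mulr_sumr; apply: rmin_le_sum => q.
  rewrite mulrA mulr_sumr mulr_suml; apply: rmin_le_sum => l.
  case: ifP => [/andP[lC qC]|_]; last by rewrite !mulr0 mul0r.
  apply: rmin_le_trans (w_le i q l lC qC) _.
  rewrite (mulrA (X i j)); apply: rmin_le_mul (rmin_le_refl _).
  apply: rmin_le_mul (rmin_le_refl _).
  exact: mp_star_step shifted_block_ge _ _ _.
have w_enter i k : i \notin C -> k \in C ->
    rmin_le (Some (d i + W i)) (B i k * w k 0).
  move=> iC kC; rewrite wE mulr_sumr; apply: rmin_le_sum => q.
  rewrite mulrA mulr_sumr mulr_suml; apply: rmin_le_sum => l.
  case: ifP => [/andP[lC qC]|_]; last by rewrite !mulr0 mul0r.
  rewrite (mulrA (B i k)); apply: rmin_le_trans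
    (rmin_le_mul (schur_le_path iC qC kC lC) (rmin_le_refl _)).
  by case Ev: (B' i q) => [v|//]; exact: B'W Ev.
exists (fun i => if i \in C then rmin_val (w i 0) else W i) => i j b Eb.
case: ifPn => iC; case: ifPn => jC.
- have := w_step i j; rewrite shifted_blockE iC jC Eb /=.
  move: (w_fin _ iC) (w_fin _ jC).
  by case: (w i 0) => [x|//] _; case: (w j 0) => [y|//] _ /=; lra.
- have := w_le i j i iC jC; rewrite Eb.
  have := mp_star_diag shifted_block_ge i; move: (w_fin _ iC).
  by case: (w i 0) => [x|//] _; case: (mp_star X i i) => [s|//] /=; lra.
- have := w_enter i j iC jC; rewrite Eb; move: (w_fin _ jC).
  by case: (w j 0) => [y|//] _ /=; lra.
- by have := schur_le_direct iC jC; rewrite Eb; case Ev: (B' i j) => [v|//] /=;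
    have := B'W _ _ _ Ev; lra.
Qed.
End Schur.

(** * The nested eliminations and the rescaled matrices *)
Section Levels.
Variables (R : realType) (n : nat) (A : 'M[Rmin R]_n) (k : nat).
Hypothesis n_gt0 : (0 < n)%N.
Hypothesis A_irr : mp_irreducible A.
Hypothesis k_last : mp_last A k.

Lemma mp_Cup_recr l : (0 < l)%N -> mp_Cup A l = (mp_Cup A l.-1 :|: mp_C A l)%SET.
Proof. by case: l => // l _; rewrite /mp_Cup big_nat_recr. Qed.

Lemma mp_CupP l i :
  reflect (exists2 m, (0 < m <= l)%N & i \in mp_C A m) (i \in mp_Cup A l).
Proof.
elim: l => [|l IH].
  rewrite /mp_Cup big_geq // inE; apply: ReflectF => -[m].
  by case: m.
rewrite mp_Cup_recr //= inE; apply: (iffP orP).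
  case=> [/IH[m ml im]|il]; last by exists l.+1; rewrite ?leqnn.
  by exists m => //; move/andP: ml => [-> /leqW].
case=> m /andP[m0]; rewrite leq_eqVlt ltnS => /predU1P[->|ml] im; first by right.
by left; apply/IH; exists m; rewrite ?m0.
Qed.

Lemma mp_N_recr l : (0 < l)%N -> mp_N A l.+1 = (mp_N A l :\: mp_C A l)%SET.
Proof. by move=> l0; rewrite /mp_N /= mp_Cup_recr // finset.setCU finset.setDE. Qed.

Lemma mp_seqS l : (0 < l)%N ->
  mp_seq A l.+1 = mp_schur (mp_C A l) (mp_alpha A l) (mp_seq A l).
Proof. by case: l. Qed.

Lemma mp_N_neq0 l : (0 < l <= k)%N -> mp_N A l != finset.set0.
Proof.
case: l => [//|[_|l lk]].
  rewrite /mp_N /mp_Cup big_geq // finset.setC0.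
  by apply/set0Pn; exists (Ordinal n_gt0); rewrite inE.
have [_ _ /(_ l.+1 lk) ne] := k_last.
rewrite /mp_N /=; apply/eqP => /(congr1 (fun X => ~: X)%SET).
by rewrite finset.setCK finset.setC0.
Qed.

(** For [n > 1] a node is linked to itself through any other node; the loop is
    only requested from matrices of size 1. *)
Lemma irreducible_linked i j : linked (mp_arc A) i j.
Proof.
have [conn n1] := A_irr; apply/linkedP.
have [ij|ij] := eqVneq i j; last first.
  have /connectP[[|x p] /= + lp] := conn i j; first by rewrite lp eqxx in ij.
  by case/andP=> ix xp; exists x; split=> //; apply/connectP; exists p.
have [nE|nE] := eqVneq n 1%N; first by exists i; split; [exact: n1|exact: conn].
have [k' ik] : exists k' : 'I_n, i != k'.
  have : (1 < #|'I_n|)%N by rewrite card_ord ltn_neqAle eq_sym nE.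
  case/card_gt1P=> x [y [_ _ xy]].
  by have [ix|] := eqVneq i x; [exists y; rewrite ix|exists x].
have /connectP[[|x p] /= + lp] := conn i k'; first by rewrite lp eqxx in ik.
by case/andP=> ix _; exists x; split.
Qed.

(** All that the theory of a single irreducible matrix requires, transported
    from one level to the next. *)
Lemma level_structure l : (0 < l <= k)%N ->
  (forall i j, mp_arc (mp_seq A l) i j -> i \in mp_N A l /\ j \in mp_N A l) /\
  {in mp_N A l &, forall i j, linked (mp_arc (mp_seq A l)) i j}.
Proof.
elim: l => [//|[|l] IH lk].
  rewrite /mp_N /mp_Cup big_geq // finset.setC0.
  split; first by move=> i j; rewrite !inE.
  by move=> i j _ _; exact: irreducible_linked.
have lk' : (0 < l.+1 <= k)%N by exact: ltnW.
have [supp lkd] := IH lk'.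
have [lam [U [c [BU cc rB]]]] := exists_critical (mp_N_neq0 lk') supp lkd.
have alphaE : mp_alpha A l.+1 = lam by rewrite /mp_alpha rB.
rewrite mp_seqS // mp_N_recr // alphaE; split.
  by move=> i j; exact: schur_supp.
exact: (schur_linked BU lkd).
Qed.

Lemma level_critical l : (0 < l <= k)%N -> exists U c,
  [/\ potential (mp_seq A l) (fun=> mp_alpha A l) U,
      critical_circuit (mp_seq A l) c &
      rho_min (mp_seq A l) = Some (mp_alpha A l)].
Proof.
move=> lk; have [supp lkd] := level_structure lk.
have [lam [U [c [BU cc rB]]]] := exists_critical (mp_N_neq0 lk) supp lkd.
by exists U, c; rewrite /mp_alpha rB; split; rewrite //= -?rB.
Qed.

Lemma mem_mp_C l c i : critical_circuit (mp_seq A l) c -> i \in c -> i \in mp_C A l.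
Proof. by move=> cc ic; rewrite inE; apply/asboolP; exists c. Qed.

Lemma mp_C_sub_N l : (0 < l <= k)%N -> mp_C A l \subset mp_N A l.
Proof.
move=> lk; have [supp _] := level_structure lk.
apply/fintype.subsetP => i; rewrite inE => /asboolP[c [[_ cc] _] ic].
have [j ij] := exists_circuit_arc ic.
by move: cc; rewrite cycle_arcs => /allP/(_ _ ij)/supp[].
Qed.

(** A circuit of the Schur complement whose mean is still [alpha_l] would
    expand into a critical circuit of the previous matrix through a node that
    has not been eliminated. *)
Lemma mp_alpha_lt_succ l : (0 < l)%N -> (l < k)%N ->
  mp_alpha A l < mp_alpha A l.+1.
Proof.
move=> l0 lk; have lk' : (0 < l <= k)%N by rewrite l0 ltnW.
have [U [_ [BU _ rB]]] := level_critical lk'.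
have [U' [c [BU' cc rB']]] := @level_critical l.+1 lk.
have B'U : potential (mp_seq A l.+1) (fun=> mp_alpha A l) U.
  by rewrite mp_seqS //; exact: schur_potential.
have [ci] := cc; have [c0 _] := ci; rewrite rB' => -[meanc].
rewrite lt_neqAle -meanc circuit_mean_le // (circuit_weight_ge B'U) // andbT.
rewrite eq_sym circuit_mean_eq //; apply/negP => /eqP wc.
have := circuit_weight_eq B'U ci wc; case: c c0 => // i c _ in cc ci meanc wc *.
move=> ct; have [j ij] : exists j, tight (mp_seq A l.+1) (fun=> mp_alpha A l) U i j /\
    connect (tight (mp_seq A l.+1) (fun=> mp_alpha A l) U) j i.
  move: ct => /=; case: c {cc ci meanc wc} => [|j c] /=.
    by rewrite andbT => ii; exists i; split.
  case/andP=> ij jc; exists j; split=> //.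
  by apply/connectP; exists (rcons c i); rewrite ?last_rcons.
have step p q : tight (mp_seq A l.+1) (fun=> mp_alpha A l) U p q ->
    linked (tight (mp_seq A l) (fun=> mp_alpha A l) U) p q.
  by rewrite mp_seqS //; exact: schur_tight.
have [/step/linkedP[m [im mj]] ji] := ij.
have mi : connect (tight (mp_seq A l) (fun=> mp_alpha A l) U) m i.
  apply: connect_trans mj _; apply: (connect_sub _ ji) => p q /step/linkedP[x [px xq]].
  exact: connect_trans (connect1 px) xq.
have [c' cc' imc] := circuit_of_arc im mi.
have c'0 : c' != [::] by case: (c') imc.
have /(critical_circuitP _ BU rB) crit : c' != [::] /\
  cycle (tight (mp_seq A l) (fun=> mp_alpha A l) U) c' by [].
have iC := mem_mp_C crit (mem_circuit_arcs imc).
have : i \in mp_N A l.+1.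
  apply: (fintype.subsetP (mp_C_sub_N (l := l.+1) lk)).
  by apply: mem_mp_C cc _; rewrite mem_head.
by rewrite mp_N_recr // inE iC.
Qed.

Lemma mp_alpha_lt m l : (0 < m)%N -> (m < l)%N -> (l <= k)%N ->
  mp_alpha A m < mp_alpha A l.
Proof.
move=> m0; elim: l => // l IH; rewrite ltnS leq_eqVlt => /predU1P[<-|ml] lk.
  exact: mp_alpha_lt_succ.
apply: lt_trans (IH ml (ltnW lk)) _.
by apply: mp_alpha_lt_succ => //; apply: leq_trans ml.
Qed.

Lemma mp_C_disjoint m m' i : (0 < m <= k)%N -> (0 < m' <= k)%N ->
  i \in mp_C A m -> i \in mp_C A m' -> m = m'.
Proof.
wlog mm' : m m' / (m < m')%N => [hw|].
  have [lt|lt|//] := ltngtP m m' => h h' im im'; first exact: hw.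
  by apply/esym; apply: hw.
move=> /andP[m0 _] m'k im im'.
have := fintype.subsetP (mp_C_sub_N m'k) _ im'; rewrite inE => /mp_CupP[].
by exists m => //; rewrite m0 -ltnS prednK // (leq_ltn_trans _ mm').
Qed.

(** ** The rows of the rescaled matrices *)

Definition hat_shift l i : R :=
  if [pick m : 'I_l | (0 < m)%N && (i \in mp_C A m)] is Some m
  then mp_alpha A m else mp_alpha A l.

Lemma mp_hatE l i j : mp_hat A l i j = rmin_fin (- hat_shift l i) * A i j.
Proof. by rewrite mxE. Qed.

Lemma hat_shift_C l m i : (0 < m <= l)%N -> (l <= k)%N -> i \in mp_C A m ->
  hat_shift l i = mp_alpha A m.
Proof.
move=> /andP[m0 ml] lk im; rewrite /hat_shift; case: pickP => [m' /andP[m'0 im']|].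
  congr mp_alpha; apply: mp_C_disjoint im' im; rewrite ?m'0 ?m0 /=.
    by rewrite ltnW // (leq_trans (ltn_ord m')).
  exact: leq_trans ml lk.
move: ml; rewrite leq_eqVlt => /predU1P[->//|ml] /(_ (Ordinal ml)).
by rewrite /= m0 im.
Qed.

Lemma hat_shift_N l i : i \in mp_N A l -> hat_shift l i = mp_alpha A l.
Proof.
rewrite inE => /mp_CupP iN; rewrite /hat_shift; case: pickP => // m /andP[m0 im].
by case: iN; exists m => //; rewrite m0 -ltnS prednK // (leq_trans _ (ltn_ord m)).
Qed.

(** The rows outside [C^l] belong to some later [C_m], whose shift
    [alpha_m] is larger than [alpha_l]. *)
Lemma hat_shift_le l i : (0 < l <= k)%N ->
  (hat_shift l i <= hat_shift k i) /\
  ((hat_shift l i == hat_shift k i) = (i \in mp_Cup A l)).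
Proof.
move=> /andP[l0 lk]; have [k0 Ck _] := k_last.
have /mp_CupP[m /andP[m0 mk] im] : i \in mp_Cup A k by rewrite Ck inE.
rewrite (@hat_shift_C k m) ?m0 //.
have [ml|lm] := leqP m l.
  rewrite (@hat_shift_C l m) ?m0 // eqxx lexx; split=> //; apply/esym/mp_CupP.
  by exists m; rewrite ?m0.
have /negP iC : ~ i \in mp_Cup A l.
  move=> /mp_CupP[m' /andP[m'0 m'l] im'].
  have Em : m' = m.
    by apply: mp_C_disjoint im' im; rewrite ?m'0 ?m0 //= (leq_trans m'l).
  by move: lm; rewrite -Em ltnNge m'l.
have iN : i \in mp_N A l.
  rewrite inE; apply: contra iC => /mp_CupP[m' /andP[m'0 m'l] im'].
  by apply/mp_CupP; exists m'; rewrite // m'0 (leq_trans m'l) ?leq_pred.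
rewrite (hat_shift_N iN) (negPf iC).
have lt := mp_alpha_lt l0 lm mk; split; first exact: ltW.
by rewrite lt_eqF.
Qed.

Lemma mp_hat_arc l : mp_arc (mp_hat A l) =2 mp_arc A.
Proof. by move=> i j; rewrite /mp_arc mp_hatE; case: (A i j). Qed.

Lemma mp_hat_circuit l c : circuit (mp_hat A l) c <-> circuit A c.
Proof. by rewrite /circuit (eq_cycle (mp_hat_arc l)). Qed.

Lemma mp_hat_circuit_weight l c : circuit A c ->
  circuit_weight (mp_hat A l) c = circuit_weight A c - \sum_(i <- c) hat_shift l i.
Proof.
move=> [_]; rewrite cycle_arcs => /allP cc.
rewrite -(circuit_sum_potential (hat_shift l) (fun=> 0)) /circuit_weight -sumrB.
apply: eq_big_seq => -[i j] /cc; rewrite /mp_arc mp_hatE /=.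
by case: (A i j) => [b|//] _ /=; lra.
Qed.

(** The potential of the matrix of level [l] at [alpha_l] is lifted through the
    Schur complements [l - 1], ..., 1; each lift puts the shift [alpha_m] on the
    rows of [C_m] and keeps the others. *)
Lemma hat_shift_potential l : (0 < l <= k)%N -> exists W, potential A (hat_shift l) W.
Proof.
move=> /andP[l0 lk].
suff down m : (m < l)%N -> exists W, potential (mp_seq A (l - m)) (hat_shift l) W.
  by have := down l.-1; rewrite ltn_predL l0 -{1}(prednK l0) subSnn; apply.
elim: m => [_|m IH ml].
  rewrite subn0; have lk' : (0 < l <= k)%N by rewrite l0.
  have [U [_ [BU _ _]]] := level_critical lk'; exists U => i j b Eb.
  have [supp _] := level_structure lk'.
  have [iN _] : i \in mp_N A l /\ j \in mp_N A l by apply: supp; rewrite /mp_arc Eb.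
  by rewrite hat_shift_N //; exact: BU.
have [W pW] := IH (ltnW ml).
set l' := (l - m.+1)%N.
have Sl' : (l - m)%N = l'.+1 by rewrite /l' subnSK // ltnW.
have l'0 : (0 < l')%N by rewrite /l' subn_gt0.
have l'l : (l' < l)%N by rewrite /l' ltn_subrL l0.
have l'k : (0 < l' <= k)%N by rewrite l'0 (leq_trans (ltnW l'l)).
have [U [_ [BU _ _]]] := level_critical l'k.
have [supp lkd] := level_structure l'k.
have ne : (mp_N A l' :\: mp_C A l')%SET != finset.set0.
  by rewrite -mp_N_recr // mp_N_neq0 //= (leq_trans l'l).
rewrite Sl' mp_seqS // in pW.
have [W' pW'] := schur_potential_lift BU lkd (mp_C_sub_N l'k) ne pW.
exists W' => i j b /pW'; case: ifP => // iC.
by rewrite (@hat_shift_C l l') // l'0 ltnW.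
Qed.

Lemma mp_hat_potential l : (0 < l <= k)%N ->
  exists W, potential (mp_hat A l) (fun=> 0) W.
Proof.
move=> /hat_shift_potential[W AW]; exists W => i j b; rewrite mp_hatE.
by case Ea: (A i j) => [a|//] [<-]; have := AW _ _ _ Ea; lra.
Qed.

(** The critical circuits of [A] stay in [C_1], whose rows are shifted by
    [alpha_1] at every level: they become circuits of weight zero. *)
Lemma rho_min_mp_hat l : (0 < l <= k)%N -> rho_min (mp_hat A l) = Some 0.
Proof.
move=> lk; have [W hW] := mp_hat_potential lk.
have [k0 _ _] := k_last; have k1 : (0 < 1 <= k)%N by [].
have [U [c [AU cc rA]]] := level_critical k1.
have [ci] := cc; have [c0 _] := ci; rewrite rA => -[/eqP].
rewrite circuit_mean_eq // => /eqP wc.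
apply: (rho_min_potential hW (c := c)); first exact/mp_hat_circuit.
rewrite mp_hat_circuit_weight // wc big1_eq; apply/eqP.
rewrite subr_eq0; apply/eqP/eq_big_seq => i ic.
have /andP[l0 l_k] := lk.
by rewrite (@hat_shift_C l 1) // (mem_mp_C cc ic).
Qed.

Lemma mp_hat_eigenvector_fin l V : (0 < l <= k)%N ->
  mp_eigenvector (mp_hat A l) V -> forall i, V i 0 = Some (rmin_val (V i 0)).
Proof.
move=> lk [V0]; rewrite rho_min_mp_hat // => HV i.
have {}HV : mp_hat A l *m V = V by rewrite HV -[RHS]scale1r.
have [j Vj] : exists j, V j 0 != None.
  apply: contrapT => nV; move/eqP: V0; apply; apply/colP => j; rewrite [RHS]mxE.
  by apply/eqP; apply: contrapT => /negP Vj; apply: nV; exists j.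
have /connectP[p pp lp] := A_irr.1 i j.
suff : V i 0 != None by case: (V i 0).
elim: p i pp lp => [|x p IH] i /=; first by move=> _ <-.
move=> /andP[ix xp] /(IH x xp) Vx; rewrite -HV mxE.
have := rmin_sum_le (fun x => mp_hat A l i x * V x 0) x.
move: ix Vx; rewrite -(mp_hat_arc l) /mp_arc.
case: (mp_hat A l i x) => [b|//] _; case: (V x 0) => [v|//] _.
by case: (\sum_j _).
Qed.

Lemma sat_mp_hat l V : (0 < l <= k)%N -> mp_eigenvector (mp_hat A l) V ->
  potential (mp_hat A l) (fun=> 0) (fun i => rmin_val (V i 0)) /\
  sat_graph (mp_hat A l) V =2 tight (mp_hat A l) (fun=> 0) (fun i => rmin_val (V i 0)).
Proof.
move=> lk eV; have Vfin := mp_hat_eigenvector_fin lk eV.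
have [_] := eV; rewrite rho_min_mp_hat // => HV.
have {}HV : mp_hat A l *m V = V by rewrite HV -[RHS]scale1r.
split=> i j.
  move=> b Eb; have := rmin_sum_le (fun x => mp_hat A l i x * V x 0) j.
  have -> : \sum_x mp_hat A l i x * V x 0 = V i 0 by rewrite -[in RHS]HV mxE.
  by rewrite Eb (Vfin i) (Vfin j) /= add0r.
rewrite /sat_graph HV /tight (Vfin i) (Vfin j) /=.
case: (mp_hat A l i j) => [b|] //=.
apply/eqP/eqP => -[]; first by move=> ->; congr Some; lra.
by move=> ->; congr Some; lra.
Qed.

Lemma cycle_sat_mp_hat l V c : (0 < l <= k)%N ->
  mp_eigenvector (mp_hat A l) V -> c != [::] ->
  cycle (sat_graph (mp_hat A l) V) c <->
  circuit A c /\ circuit_weight A c = \sum_(i <- c) hat_shift l i.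
Proof.
move=> lk eV c0; have [pV satE] := sat_mp_hat lk eV; rewrite (eq_cycle satE).
split.
  move=> /(circuit_tight c0)[/mp_hat_circuit cc]; rewrite mp_hat_circuit_weight //.
  by rewrite big1_eq => /eqP; rewrite subr_eq0 => /eqP.
move=> [cc wc]; apply: (circuit_weight_eq pV); first exact/mp_hat_circuit.
by rewrite mp_hat_circuit_weight // wc subrr big1_eq.
Qed.

(** A circuit may combine arcs of several critical circuits; each of them is
    tight for one and the same potential, which makes the whole circuit
    critical. *)
Lemma cycle_critical_mp_hat l c : (0 < l <= k)%N -> c != [::] ->
  cycle (critical_graph (mp_hat A l)) c <->
  circuit A c /\ circuit_weight A c = \sum_(i <- c) hat_shift l i.
Proof.
move=> lk c0; have [W pW] := mp_hat_potential lk.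
have rho0 := rho_min_mp_hat lk.
split.
  move=> cc; have ct : cycle (tight (mp_hat A l) (fun=> 0) W) c.
    apply: sub_cycle cc => i j /asboolP[c' /(critical_circuitP _ pW rho0)[_ c't] ijc'].
    by move: c't; rewrite cycle_arcs => /allP/(_ _ ijc').
  have [/mp_hat_circuit ci] := circuit_tight c0 ct.
  rewrite mp_hat_circuit_weight //.
  by rewrite big1_eq => /eqP; rewrite subr_eq0 => /eqP.
move=> [cc wc]; rewrite cycle_arcs; apply/allP => -[i j] ijc.
apply/asboolP; exists c => //; apply/(critical_circuitP _ pW rho0); split=> //.
apply: (circuit_weight_eq pW); first exact/mp_hat_circuit.
by rewrite mp_hat_circuit_weight // wc subrr big1_eq.
Qed.

(** Raising the shifts of the rows outside [C^l] from [alpha_l] to their final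
    values can only lower the weights, strictly on every circuit that uses such
    a row; the tight circuits at level [l] are thus the final ones that stay
    inside [C^l]. *)
Lemma cycle_sat_mp_hat_last l V G c : (0 < l <= k)%N ->
  mp_eigenvector (mp_hat A l) V ->
  G = critical_graph (mp_hat A k) \/
    (exists2 V', mp_eigenvector (mp_hat A k) V' & G = sat_graph (mp_hat A k) V') ->
  cycle (sat_graph (mp_hat A l) V) c =
  cycle (fun i j => [&& G i j, i \in mp_Cup A l & j \in mp_Cup A l]) c.
Proof.
move=> lk eV GE; case: c => [//|i0 c]; set cc := i0 :: c.
have cc0 : cc != [::] by [].
have kk : (0 < k <= k)%N by rewrite leqnn andbT; case/andP: lk => /leq_trans; apply.
have GP : cycle G cc <->
    circuit A cc /\ circuit_weight A cc = \sum_(i <- cc) hat_shift k i.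
  by case: GE => [->|[V' eV' ->]];
    [exact: cycle_critical_mp_hat|exact: cycle_sat_mp_hat].
have subP : cycle (fun i j => [&& G i j, i \in mp_Cup A l & j \in mp_Cup A l]) cc
    <-> cycle G cc /\ {in cc, forall i, i \in mp_Cup A l}.
  split=> [|[]].
    move=> h; split; first by apply: sub_cycle h => i j /and3P[].
    move=> i /exists_circuit_arc[j ij].
    by move: h; rewrite cycle_arcs => /allP/(_ _ ij)/and3P[].
  move=> h all_in; apply: (sub_in_cycle (P := mem (mp_Cup A l))) h; last exact/allP.
  by move=> i j iC jC /= ->; rewrite iC.
have [W pW] := hat_shift_potential kk.
apply/idP/idP.
  move=> /(cycle_sat_mp_hat lk eV cc0)[ci wc]; apply/subP.
  have ge_k := circuit_weight_ge pW ci.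
  have le_lk i := (hat_shift_le i lk).1.
  have le_sum (s : seq 'I_n) :
    \sum_(i <- s) hat_shift l i <= \sum_(i <- s) hat_shift k i.
    by apply: ler_sum => i _.
  have eq_sum : \sum_(i <- cc) hat_shift l i = \sum_(i <- cc) hat_shift k i.
    by apply/eqP; rewrite eq_le le_sum -wc ge_k.
  split; first by apply/GP; rewrite -eq_sum.
  move=> i ic; rewrite -(hat_shift_le i lk).2 eq_le le_lk leNgt.
  apply/negP => lt; move: ic => /splitPr Ecc.
  move: eq_sum; case: Ecc => p1 p2; rewrite !big_cat !big_cons /=.
  by have := le_sum p1; have := le_sum p2; lra.
move=> /subP[/GP[ci wc] all_in]; apply/(cycle_sat_mp_hat lk eV cc0); split=> //.
rewrite wc; apply: eq_big_seq => i /all_in.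
by rewrite -(hat_shift_le i lk).2 => /eqP.
Qed.
End Levels.

(** * Determinants of pencils *)

(** The product attached to a permutation in the determinant runs along the
    cycles of this permutation; off the diagonal, only those entries that lie
    on a cycle of the graph matter. *)
Lemma det_eq_cycles (F : comNzRingType) n (D : 'I_n -> F) (b : 'M[F]_n)
    (S S' : rel 'I_n) : (forall c, cycle S c = cycle S' c) ->
  \det (\matrix_(i, j) (D i *+ (i == j) - (if S i j then b i j else 0))) =
  \det (\matrix_(i, j) (D i *+ (i == j) - (if S' i j then b i j else 0))).
Proof.
move=> SS'; apply: eq_bigr => /= s _; congr (_ * _).
pose on (T : rel 'I_n) := [forall i, (s i != i) ==> T i (s i)].
have on_sub (T T' : rel 'I_n) : (forall c, cycle T c = cycle T' c) -> on T -> on T'.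
  move=> TT' /forallP onT; apply/forallP => i; apply/implyP => si.
  have moved : {in orbit s i, forall j, s j != j}.
    move=> j; rewrite -fconnect_orbit => /iter_findex <-.
    by elim: (findex _ _ _) => //= m; rewrite (inj_eq perm_inj).
  have next_s : next (orbit s i) i = s i.
    by apply/esym/eqP; apply: (next_cycle (cycle_orbit perm_inj i)); exact: in_orbit.
  have : cycle T (orbit s i).
    apply: (sub_in_cycle (P := [pred j | s j != j])) (cycle_orbit perm_inj i).
      by move=> j j' sj _ /eqP <-; exact: (implyP (onT j)).
    exact/allP.
  by rewrite TT' => /next_cycle/(_ (in_orbit s i)); rewrite next_s.
have on_eq : on S = on S' by apply/idP/idP; apply: on_sub.
pose M (T : rel 'I_n) : 'M[F]_n :=
  \matrix_(i, j) (D i *+ (i == j) - (if T i j then b i j else 0)).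
have prod0 T : ~~ on T -> \prod_i M T i (s i) = 0.
  case/forallPn => i; rewrite negb_imply => /andP[si nT].
  by rewrite (bigD1 i) //= mxE eq_sym (negPf si) (negPf nT) subr0 mul0r.
have [onS|offS] := boolP (on S); last by rewrite -/(M S) -/(M S') !prod0 -?on_eq.
have onS' : on S' by rewrite -on_eq.
apply: eq_bigr => i _; rewrite !mxE; congr (_ - _).
have [si|si] := eqVneq (s i) i.
  by rewrite si; have := SS' [:: i]; rewrite /= !andbT => ->.
by rewrite (implyP (forallP onS i) si) (implyP (forallP onS' i) si).
Qed.

Lemma det_block_schur (F : comUnitRingType) p q (M11 : 'M[F]_p) (M12 : 'M[F]_(p, q))
    (M21 : 'M[F]_(q, p)) (M22 : 'M[F]_q) : M11 \in unitmx ->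
  \det (block_mx M11 M12 M21 M22) =
  \det M11 * \det (M22 - M21 *m invmx M11 *m M12).
Proof.
move=> u11; have -> : block_mx M11 M12 M21 M22 =
    block_mx 1%:M 0 (M21 *m invmx M11) 1%:M *m
    block_mx M11 M12 0 (M22 - M21 *m invmx M11 *m M12).
  rewrite mulmx_block !mul1mx !mul0mx !addr0 -mulmxA mulVmx // mulmx1.
  by rewrite addrC subrK.
by rewrite det_mulmx det_lblock det_ublock !det1 !mul1r.
Qed.

Lemma det_mxsub_bij (F : comNzRingType) m n (f : 'I_m -> 'I_n) (M : 'M[F]_n) :
  bijective f -> \det (mxsub f f M) = \det M.
Proof.
move=> bf; have := bij_eq_card bf; rewrite !card_ord => mn.
case: _ / mn in f bf M *.
pose s := perm (bij_inj bf).
have -> : mxsub f f M = row_perm s (col_perm s M).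
  by apply/matrixP => i j; rewrite !mxE !permE.
rewrite row_permE col_permE !det_mulmx !det_perm odd_permV mulrC -mulrA.
by rewrite -signr_addb addbb mulr1.
Qed.

Section Pencil.
Variables (R : realType) (n : nat).
Implicit Types (b g : 'M[R[i]]_n) (N C : {set 'I_n}).

Definition pencil N b : 'M[{poly R[i]}]_n :=
  \matrix_(i, j) ('X *+ (i \in N) *+ (i == j) - (b i j)%:P).

Lemma horner_pencil N b x :
  map_mx (horner_eval x) (pencil N b) = x *: diag_ind R N - b.
Proof.
apply/matrixP => i j; rewrite !mxE /horner_eval hornerD hornerN hornerC !hornerMn.
rewrite hornerX; case: eqP => [->|_]; rewrite ?mulr0 //.
by case: (_ \in _); rewrite ?mulr1 ?mulr0.
Qed.

(** Ordering the nodes as [C1], [C2] and the remaining ones turns the pencil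
    into a block matrix, whose Schur complement is the characteristic matrix
    of the block [C2] of the Schur complement of [b], next to a scalar block. *)
Lemma det_pencil C1 C2 b g : [disjoint C1 & C2] ->
  (forall i j, b i j =
     if (i \in C1 :|: C2) && (j \in C1 :|: C2) then g i j else 0) ->
  principal_submx C1 g \in unitmx ->
  \det (pencil (~: C1) b) = (\det (- principal_submx C1 g))%:P *
    char_poly (principal_submx C2 (cschur C1 g)) * 'X^#|~: (C1 :|: C2)|.
Proof.
move=> C12 bE ru; set r := principal_submx C1 g in ru *.
pose C3 := ~: (C1 :|: C2).
have inC1 k : (@enum_val _ (mem C1) k) \in C1 by exact: enum_valP.
have inC2 k : (@enum_val _ (mem C2) k) \in C2 by exact: enum_valP.
have inC3 k : (@enum_val _ (mem C3) k) \in C3 by exact: enum_valP.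
have n21 i : i \in C2 -> (i \in C1) = false.
  by move=> i2; apply/negP => i1; move/pred0P: C12 => /(_ i); rewrite /= i1 i2.
have n31 i : i \in C3 -> (i \in C1) = false.
  by rewrite !inE negb_or => /andP[/negPf].
have n32 i : i \in C3 -> (i \in C2) = false.
  by rewrite !inE negb_or => /andP[_ /negPf].
pose f (k : 'I_(#|C1| + (#|C2| + #|C3|))) : 'I_n :=
  match fintype.split k with
  | inl k1 => @enum_val _ (mem C1) k1
  | inr k' => match fintype.split k' with
              | inl k2 => @enum_val _ (mem C2) k2
              | inr k3 => @enum_val _ (mem C3) k3
              end
  end.
have f1 k : f (lshift _ k) = @enum_val _ (mem C1) k.
  by rewrite /f (unsplitK (inl k)).
have f2 k : f (rshift _ (lshift _ k)) = @enum_val _ (mem C2) k.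
  by rewrite /f (unsplitK (inr _)) (unsplitK (inl k)).
have f3 k : f (rshift _ (rshift _ k)) = @enum_val _ (mem C3) k.
  by rewrite /f (unsplitK (inr _)) (unsplitK (inr k)).
have f_inj : injective f.
  move=> x y.
  case: (split_ordP x) => [x1|x'] ->; last case: (split_ordP x') => [x2|x3] ->;
  (case: (split_ordP y) => [y1|y'] ->; last case: (split_ordP y') => [y2|y3] ->);
  rewrite ?f1 ?f2 ?f3 => E; rewrite ?(enum_val_inj E) //.
  - by have := inC1 x1; rewrite E n21.
  - by have := inC1 x1; rewrite E n31.
  - by have := inC1 y1; rewrite -E n21.
  - by have := inC2 x2; rewrite E n32.
  - by have := inC1 y1; rewrite -E n31.
  - by have := inC2 y2; rewrite -E n32.
have f_bij : bijective f.
  apply: inj_card_bij => //; rewrite [leqRHS]card_ord addnA -(cardsC (C1 :|: C2)).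
  by rewrite leq_add2r (leq_card_setU C1 C2).
set e1 := @enum_val _ (mem C1) in f1 inC1.
set e2 := @enum_val _ (mem C2) in f2 inC2.
set e3 := @enum_val _ (mem C3) in f3 inC3.
pose P p q (M : 'M[R[i]]_(p, q)) := map_mx (@polyC _) M.
have blockE : mxsub f f (pencil (~: C1) b) = block_mx (P _ _ (- r))
    (row_mx (P _ _ (- mxsub e1 e2 g)) 0) (col_mx (P _ _ (- mxsub e2 e1 g)) 0)
    (block_mx ('X%:M - P _ _ (mxsub e2 e2 g)) 0 0 'X%:M).
  have entry x y : mxsub f f (pencil (~: C1) b) x y =
      'X *+ (f x \notin C1) *+ (x == y) - (b (f x) (f y))%:P.
    by rewrite !mxE inE (inj_eq f_inj).
  have in3 k3 : e3 k3 \in C1 :|: C2 = false.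
    by have := inC3 k3; rewrite inE => /negPf.
  have in1 k1 : e1 k1 \in C1 :|: C2 by rewrite inE inC1.
  have in2 k2 : e2 k2 \in C1 :|: C2 by rewrite inE inC2 orbT.
  have split_l p q (k : 'I_p) : fintype.split (lshift q k) = inl k.
    exact: (unsplitK (inl k)).
  have split_r p q (k : 'I_q) : fintype.split (rshift p k) = inr k.
    exact: (unsplitK (inr k)).
  apply/matrixP => x y; rewrite entry bE.
  case: (split_ordP x) => [x1|x'] ->; last case: (split_ordP x') => [x2|x3] ->;
  (case: (split_ordP y) => [y1|y'] ->; last case: (split_ordP y') => [y2|y3] ->);
  rewrite ?f1 ?f2 ?f3 ?in1 ?in2 ?in3 /= ?inC1 ?(n21 _ (inC2 _)) ?(n31 _ (inC3 _)) /=
    ?mulr0n ?mul0rn ?eq_shift ?subr0 ?mulr0n ?sub0r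
    ?block_mxEul ?block_mxEur ?block_mxEdl ?block_mxEdr
    ?row_mxEl ?row_mxEr ?col_mxEu ?col_mxEd
    ?block_mxEul ?block_mxEur ?block_mxEdl ?block_mxEdr ?mxE
    ?split_l ?split_r ?mxE ?rmorphN //=.
have rE : P _ _ (- r) *m P _ _ (- invmx r) = 1%:M.
  by rewrite -map_mxM mulNmx mulmxN opprK mulmxV // map_mx1.
have [Pu _] := mulmx1_unit rE.
have invE : invmx (P _ _ (- r)) = P _ _ (- invmx r).
  by rewrite -[LHS]mulmx1 -rE mulKmx.
rewrite -(det_mxsub_bij _ f_bij) blockE det_block_schur // det_map_mx -mulrA.
congr (_ * _); rewrite invE mul_col_mx mul_col_row !mul0mx !mulmx0.
rewrite opp_block_mx add_block_mx !oppr0 !addr0 det_ublock det_scalar.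
congr (\det _ * _); rewrite -!map_mxM -addrA -opprD -map_mxD.
rewrite !(mulmxN, mulNmx) opprK; congr (_ - map_mx _ _).
apply/matrixP => x y; rewrite !mxE; congr (_ - _).
apply: eq_bigr => p _; rewrite !mxE; congr (_ * _).
by apply: eq_bigr => q _; rewrite !mxE.
Qed.
End Pencil.

(** * One-dimensional kernels and adjugates *)

(** Replacing row [j] of [Q] by the [k]-th unit row does not change the
    cofactors of this row, and the new matrix maps [u] to a multiple of the
    [j]-th unit vector; Cramer's rule for it is the stated relation. *)
Lemma adj_kernel_proportional (F : comNzRingType) n (Q : 'M[F]_n)
    (u : 'cV[F]_n) k j i :
  Q *m u = 0 -> \adj Q k j * u i 0 = u k 0 * \adj Q i j.
Proof.
move=> Qu; pose M : 'M[F]_n := \matrix_(p, q) if p == j then (q == k)%:R else Q p q.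
have cofM q : cofactor M j q = cofactor Q j q.
  congr (_ * \det _); apply/matrixP => x y.
  by rewrite !mxE eq_sym (negPf (neq_lift _ _)).
have detM : \det M = \adj Q k j.
  rewrite (expand_det_row _ j) (bigD1 k) //= big1 => [|q /negPf qk].
    by rewrite !mxE !eqxx mul1r addr0 cofM.
  by rewrite mxE eqxx qk mul0r.
have Mu p : (M *m u) p 0 = (p == j)%:R * u k 0.
  rewrite mxE; have [->|pj] := eqVneq p j.
    rewrite (bigD1 k) //= big1 => [|q /negPf qk]; last by rewrite mxE eqxx qk mul0r.
    by rewrite mxE !eqxx addr0.
  rewrite mul0r -[RHS](_ : (Q *m u) p 0 = 0); last by rewrite Qu mxE.
  by rewrite mxE; apply: eq_bigr => q _; rewrite mxE (negPf pj).
have /matrixP/(_ i 0) : \adj M *m (M *m u) = \det M *: u.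
  by rewrite mulmxA mul_adj_mx mul_scalar_mx.
rewrite mxE (bigD1 j) //= big1 => [|p /negPf pj]; last by rewrite Mu pj mul0r mulr0.
by rewrite Mu eqxx mul1r addr0 !mxE cofM detM mulrC mxE => ->.
Qed.

(** Differentiate [Q * adj Q = det Q]: if the adjugate vanished at [mu], then
    [Q.[mu]] times its derivative would be the nonzero scalar matrix of
    [(det Q)'.[mu]], although [Q.[mu]] is singular. *)
Lemma adj_neq0_simple_root (F : fieldType) n (Q : 'M[{poly F}]_n) (mu : F) :
  (0 < n)%N -> (\det Q).[mu] = 0 -> (\det Q)^`().[mu] != 0 ->
  exists k j, (\adj Q k j).[mu] != 0.
Proof.
move=> n0 root_mu; apply: contraNP => /forallNP adj0.
have {}adj0 k j : (\adj Q k j).[mu] = 0.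
  by apply/eqP; apply: contrapT => /negP h; apply: (adj0 k); exists j.
pose adj' := map_mx (fun p : {poly F} => p^`().[mu]) (\adj Q).
have : map_mx (horner_eval mu) Q *m adj' = ((\det Q)^`().[mu])%:M.
  apply/matrixP => i j.
  have detE : \sum_k Q i k * \adj Q k j = \det Q *+ (i == j).
    by have /matrixP/(_ i j) := mul_mx_adj Q; rewrite mxE [RHS]mxE.
  rewrite [in RHS]mxE -hornerMn -derivMn -detE raddf_sum horner_sum mxE.
  apply: eq_bigr => k _.
rewrite [RHS]/= derivM hornerD !hornerM adj0 mulr0 add0r.
  by rewrite [_ i k]mxE [_ k j]mxE.
move=> /(congr1 determinant); rewrite det_mulmx.
have -> : \det (map_mx (horner_eval mu) Q) = 0.
  by rewrite -[RHS]root_mu; exact: det_map_mx.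
rewrite mul0r; by rewrite det_scalar => /esym/eqP; rewrite expf_eq0 n0.
Qed.

Lemma simple_root_deriv (F : fieldType) (p : {poly F}) mu :
  mup mu p = 1%N -> p != 0 ->
  p.[mu] = 0 /\ p^`().[mu] != 0.
Proof.
move=> mup1 p0; have := XsubC_dvd mu p0; rewrite mup1 => /dvdpP[q Dp].
have := mup_leq mu 1 p0; rewrite mup1 leqnn => /esym/negP ndvd; rewrite Dp; split.
  by rewrite hornerM hornerXsubC subrr mulr0.
rewrite derivM hornerD !hornerM hornerXsubC subrr mulr0 add0r derivXsubC hornerC mulr1.
apply/negP => /eqP q0; apply: ndvd; rewrite Dp expr2 dvdp_mul // dvdp_XsubCl.
exact/rootP.
Qed.

Lemma simple_root_scale (F : fieldType) (p : {poly F}) c m mu :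
  c != 0 -> mu != 0 -> mup mu p = 1%N -> p != 0 ->
  (c%:P * p * 'X^m).[mu] = 0 /\ (c%:P * p * 'X^m)^`().[mu] != 0.
Proof.
move=> c0 mu0 mup1 p0; have [root_p deriv_p] := simple_root_deriv mup1 p0.
rewrite derivM hornerD derivM derivC mul0r add0r !hornerM !hornerC hornerXn.
rewrite root_p !mulr0 !mul0r addr0; split=> //.
by rewrite !mulf_neq0 // expf_neq0.
Qed.

(** * Limits at [0+] of complex functions *)
Section Limits.
Local Open Scope classical_set_scope.
Local Open Scope ring_scope.
Variable R : realType.
Implicit Types (f g : R -> R[i]) (b c : R[i]).

Definition tends f b : Prop :=
  ((f e : R[i]^o) @[e --> (0 : R)^'+] --> (b : R[i]^o))%classic.

Lemma tends_cst b : tends (fun=> b) b.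
Proof. exact: cvg_cst. Qed.

Lemma tendsD f g b c : tends f b -> tends g c -> tends (fun e => f e + g e) (b + c).
Proof. exact: cvgD. Qed.

Lemma tendsN f b : tends f b -> tends (fun e => - f e) (- b).
Proof. exact: cvgN. Qed.

Lemma tendsM f g b c : tends f b -> tends g c -> tends (fun e => f e * g e) (b * c).
Proof. exact: (@cvgM _ _ _ _ (f : R -> R[i]^o) g b c). Qed.

Lemma tendsV f b : b != 0 -> tends f b -> tends (fun e => (f e)^-1) b^-1.
Proof. by move=> b0; exact: (@cvgV _ _ _ _ (f : R -> R[i]^o) b b0). Qed.

Lemma tends_near f g b : (\forall e \near 0^'+, f e = g e) -> tends g b -> tends f b.
Proof.
move=> fg; apply: cvg_trans; apply: near_eq_cvg.
by near=> e; apply/esym; near: e.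
Unshelve. all: by end_near. Qed.

Lemma tends_sum (I : Type) (r : seq I) (P : pred I) (f : I -> R -> R[i])
    (b : I -> R[i]) :
  (forall i, tends (f i) (b i)) ->
  tends (fun e => \sum_(i <- r | P i) f i e) (\sum_(i <- r | P i) b i).
Proof.
move=> fb; elim: r => [|x r IH].
  by rewrite big_nil; under eq_fun do rewrite big_nil; exact: tends_cst.
rewrite big_cons; under eq_fun do rewrite big_cons.
by case: ifP => _; [exact: (tendsD (fb x) IH)|exact: IH].
Qed.

Lemma tends_prod (I : Type) (r : seq I) (P : pred I) (f : I -> R -> R[i])
    (b : I -> R[i]) :
  (forall i, tends (f i) (b i)) ->
  tends (fun e => \prod_(i <- r | P i) f i e) (\prod_(i <- r | P i) b i).
Proof.
move=> fb; elim: r => [|x r IH].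
  by rewrite big_nil; under eq_fun do rewrite big_nil; exact: tends_cst.
rewrite big_cons; under eq_fun do rewrite big_cons.
by case: ifP => _; [exact: (tendsM (fb x) IH)|exact: IH].
Qed.

Lemma tendsX f b n : tends f b -> tends (fun e => f e ^+ n) (b ^+ n).
Proof.
move=> fb; elim: n => [|n IH].
  by rewrite expr0; under eq_fun do rewrite expr0; exact: tends_cst.
by rewrite exprS; under eq_fun do rewrite exprS; exact: tendsM.
Qed.

Lemma tendsP f b : tends f b <->
  forall r : R, 0 < r -> \forall e \near 0^'+, `|f e - b| < r%:C%C.
Proof.
split.
  move=> /cvgrPdist_lt fb r r0; have r0' : 0 < r%:C%C :> R[i] by rewrite ltcR.
  by near=> e; rewrite distrC; near: e; exact: fb.
move=> fb; apply/cvgrPdist_lt => r r0.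
have Er : r = (complex.Re r)%:C%C by rewrite RRe_real // ger0_real // ltW.
have r0' : 0 < complex.Re r by rewrite -ltcR -Er.
by near=> e; rewrite distrC Er; near: e; exact: fb.
Unshelve. all: by end_near. Qed.

Lemma tends_neq0 f b : b != 0 -> tends f b -> \forall e \near 0^'+, f e != 0.
Proof.
move=> b0 /tendsP fb; have Eb : `|b| = (complex.Re `|b|)%:C%C.
  by rewrite RRe_real // normr_real.
have b0' : 0 < complex.Re `|b| by rewrite -ltcR -Eb normr_gt0.
near=> e; apply/eqP => fe0.
have : `|f e - b| < (complex.Re `|b|)%:C%C by near: e; exact: fb.
by rewrite fe0 sub0r normrN -Eb ltxx.
Unshelve. all: by end_near. Qed.

Lemma tends_real (h : R -> R) (x : R) : (h e @[e --> (0 : R)^'+] --> x)%classic ->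
  tends (fun e => (h e)%:C%C) x%:C%C.
Proof.
move=> /cvgrPdist_lt hx; apply/tendsP => r r0; near=> e.
have -> : (h e)%:C%C - x%:C%C = (h e - x)%:C%C by rewrite rmorphB.
rewrite normc_def /= expr0n /= addr0 sqrtr_sqr ltcR distrC.
by near: e; exact: hx.
Unshelve. all: by end_near. Qed.

Lemma tends_squeeze0 f b (g : R -> R[i]) : tends g 0 ->
  (\forall e \near 0^'+, `|f e - b| <= `|g e|) -> tends f b.
Proof.
move=> /tendsP g0 fg; apply/tendsP => r r0; near=> e.
apply: le_lt_trans (_ : `|g e| < _); first by near: e.
by rewrite -[g e]subr0; near: e; exact: g0.
Unshelve. all: by end_near. Qed.

End Limits.

(** * Simple roots of a converging family of polynomials *)
Lemma leq_size_deriv (F : nzRingType) (p : {poly F}) : (size p^`() <= size p)%N.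
Proof.
by have [->|/lt_size_deriv/ltnW//] := eqVneq p 0; rewrite deriv0 size_poly0.
Qed.

Lemma size_det_leq (F : idomainType) n (M : 'M[{poly F}]_n) :
  (forall i j, (size (M i j) <= 2)%N) -> (size (\det M) <= n.+1)%N.
Proof.
move=> M2; apply: (leq_trans (size_sum _ _ _)); apply/bigmax_leqP => s _.
rewrite size_Msign; apply: leq_trans (size_poly_prod_leq _ _) _.
rewrite leq_subLR card_ord addnS ltnS.
apply: (@leq_trans (\sum_(i < n) 2)%N); first exact: leq_sum.
by rewrite sum_nat_const card_ord muln2 addnn.
Qed.

Section Roots.
Variable R : realType.
Local Open Scope classical_set_scope.
Local Open Scope ring_scope.
Local Notation C := R[i].

(** Coefficientwise convergence: the degree may drop in the limit, which happens
    for pencils with a singular leading part. *)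
Definition poly_tends (p : R -> {poly C}) (p0 : {poly C}) : Prop :=
  forall k, tends (fun e => (p e)`_k) p0`_k.

Lemma poly_tends_cst (p0 : {poly C}) : poly_tends (fun=> p0) p0.
Proof. by move=> k; exact: tends_cst. Qed.

Lemma poly_tendsD p q p0 q0 : poly_tends p p0 -> poly_tends q q0 ->
  poly_tends (fun e => p e + q e) (p0 + q0).
Proof.
move=> pp0 qq0 k; rewrite coefD; under eq_fun do rewrite coefD; exact: tendsD.
Qed.

Lemma poly_tendsM p q p0 q0 : poly_tends p p0 -> poly_tends q q0 ->
  poly_tends (fun e => p e * q e) (p0 * q0).
Proof.
move=> pp0 qq0 k; rewrite coefM; under eq_fun do rewrite coefM.
by apply: tends_sum => i; exact: tendsM.
Qed.

Lemma poly_tends_sum (I : Type) (r : seq I) (P : pred I) (p : I -> R -> {poly C})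
    (p0 : I -> {poly C}) : (forall i, poly_tends (p i) (p0 i)) ->
  poly_tends (fun e => \sum_(i <- r | P i) p i e) (\sum_(i <- r | P i) p0 i).
Proof.
move=> pp0; elim: r => [|i r IH].
  by rewrite big_nil; under eq_fun do rewrite big_nil; exact: poly_tends_cst.
rewrite big_cons; under eq_fun do rewrite big_cons.
by case: ifP => _; [exact: (poly_tendsD (pp0 i) IH)|exact: IH].
Qed.

Lemma poly_tends_prod (I : Type) (r : seq I) (P : pred I) (p : I -> R -> {poly C})
    (p0 : I -> {poly C}) : (forall i, poly_tends (p i) (p0 i)) ->
  poly_tends (fun e => \prod_(i <- r | P i) p i e) (\prod_(i <- r | P i) p0 i).
Proof.
move=> pp0; elim: r => [|i r IH].
  by rewrite big_nil; under eq_fun do rewrite big_nil; exact: poly_tends_cst.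
rewrite big_cons; under eq_fun do rewrite big_cons.
by case: ifP => _; [exact: (poly_tendsM (pp0 i) IH)|exact: IH].
Qed.

Lemma poly_tends_det n (M : R -> 'M[{poly C}]_n) (M0 : 'M[{poly C}]_n) :
  (forall i j, poly_tends (fun e => M e i j) (M0 i j)) ->
  poly_tends (fun e => \det (M e)) (\det M0).
Proof.
move=> MM0; apply: poly_tends_sum => s.
by apply: poly_tendsM; [exact: poly_tends_cst|apply: poly_tends_prod].
Qed.

Lemma poly_tends_deriv p p0 :
  poly_tends p p0 -> poly_tends (fun e => (p e)^`()) p0^`().
Proof.
move=> pp0 k; rewrite coef_deriv -mulr_natr.
under eq_fun do rewrite coef_deriv -mulr_natr.
by apply: tendsM; [exact: pp0|exact: tends_cst].
Qed.

Lemma tends_horner N (p : R -> {poly C}) (p0 : {poly C}) (x : R -> C) (x0 : C) :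
  (forall e, (size (p e) <= N)%N) -> (size p0 <= N)%N ->
  poly_tends p p0 -> tends x x0 -> tends (fun e => (p e).[x e]) p0.[x0].
Proof.
move=> szp szp0 pp0 xx0; rewrite (horner_coef_wide _ szp0).
under eq_fun do rewrite (horner_coef_wide _ (szp _)).
by apply: tends_sum => k; apply: tendsM; [exact: pp0|exact: tendsX].
Qed.

(** The logarithmic derivative of [p] at [x] is the sum of the [1 / (x - z)]
    over the roots [z], so one of them has at least the mean modulus. *)
Lemma exists_close_root N (p : {poly C}) (x : C) :
  (size p <= N.+1)%N -> p^`().[x] != 0 ->
  exists2 z, root p z & `|z - x| <= N%:R * (`|p.[x]| / `|p^`().[x]|).
Proof.
move=> szp dp; have [px0|px] := eqVneq p.[x] 0.
  by exists x; [exact/rootP|rewrite subrr normr0 px0 normr0 mul0r mulr0].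
have [r Dp] := closed_field_poly_normal p.
have rE z : root p z = (z \in r).
  rewrite Dp rootZ ?root_prod_XsubC // lead_coef_eq0.
  by apply: contraNneq px => ->; rewrite horner0.
have szr : (size r <= N)%N.
  have := szp; rewrite Dp size_scale ?size_prod_XsubC //.
  by rewrite lead_coef_eq0; apply: contraNneq px => ->; rewrite horner0.
have xz z : z \in r -> x - z != 0.
  by rewrite subr_eq0; apply: contraTneq => <-; rewrite -rE.
have logder : p^`().[x] = p.[x] * \sum_(z <- r) (x - z)^-1.
  rewrite {1 2}Dp derivZ !hornerZ -mulrA; congr (_ * _).
  elim: r xz {rE szr Dp} => [|z r IH] xz.
    by rewrite !big_nil derivC horner0 mulr0.
  rewrite !big_cons derivM derivXsubC mul1r hornerD !hornerM hornerXsubC.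
  rewrite IH => [|y yr]; last by apply: xz; rewrite inE yr orbT.
  have := xz z (mem_head _ _) => xz0.
  rewrite mulrDr [X in _ = X + _]mulrAC divff // mul1r; congr (_ + _).
  by rewrite mulrA.
have dp0 : 0 < `|p^`().[x]| by rewrite normr_gt0.
have p_gt0 : 0 < `|p.[x]| by rewrite normr_gt0.
apply: contrapT => far.
have {}far z : z \in r -> N%:R * `|p.[x]| * `|x - z|^-1 < `|p^`().[x]|.
  move=> zr; rewrite ltr_pdivrMr ?normr_gt0 ?xz // -ltr_pdivrMl // mulrC -mulrA.
  rewrite real_ltNge ?realM ?realV ?normr_real ?ger0_real ?ler0n //.
  by apply/negP => le_z; apply: far; exists z; rewrite ?rE // distrC.
have : N%:R * `|p^`().[x]| < N%:R * `|p^`().[x]|.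
  apply: (@le_lt_trans _ _ (\sum_(z <- r) N%:R * `|p.[x]| * `|x - z|^-1)).
    rewrite -mulr_sumr {1}logder normrM mulrA ler_wpM2l ?mulr_ge0 //.
    rewrite (le_trans (ler_norm_sum _ _ _)) // ler_sum // => z _.
    by rewrite normfV.
  apply: (@lt_le_trans _ _ (\sum_(z <- r) `|p^`().[x]|)).
    rewrite big_seq [ltRHS]big_seq; apply: ltr_sum => //.
    case: (r) logder dp => [->|z r' _ _]; first by rewrite big_nil mulr0 eqxx.
    by rewrite /= mem_head.
  rewrite big_const_seq count_predT iter_addr addr0 -[leLHS]mulr_natl.
  by rewrite ler_wpM2r // ler_nat.
by rewrite ltxx.
Qed.

Lemma tends_root N (p : R -> {poly C}) (p0 : {poly C}) (mu : C) :
  (forall e, (size (p e) <= N.+1)%N) ->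
  (size p0 <= N.+1)%N -> poly_tends p p0 -> p0.[mu] = 0 -> p0^`().[mu] != 0 ->
  exists2 x, tends x mu & \forall e \near 0^'+, root (p e) (x e).
Proof.
move=> szp szp0 pp0 root_mu dmu.
have /choice[x xP] e : exists z, (p e)^`().[mu] != 0 -> root (p e) z /\
    `|z - mu| <= N%:R * (`|(p e).[mu]| / `|(p e)^`().[mu]|).
  have [d0|d0] := eqVneq (p e)^`().[mu] 0; first by exists 0.
  by have [z ? ?] := exists_close_root (szp e) d0; exists z.
have pmu := tends_horner szp szp0 pp0 (@tends_cst _ mu).
have dpmu : tends (fun e => (p e)^`().[mu]) p0^`().[mu].
  apply: (@tends_horner N.+1) (poly_tends_deriv pp0) (@tends_cst _ mu).
    by move=> e; exact: leq_trans (leq_size_deriv _) (szp e).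
  exact: leq_trans (leq_size_deriv _) szp0.
have nz := tends_neq0 dmu dpmu.
exists x; last first.
  near=> e; have /xP[//] : (p e)^`().[mu] != 0 by near: e; exact: nz.
apply: (@tends_squeeze0 _ _ _ (fun e => N%:R * ((p e).[mu] / (p e)^`().[mu]))).
  rewrite -[X in tends _ X](mulr0 N%:R).
  rewrite -[X in _ * X](mul0r (p0^`().[mu])^-1) -[X in X / _]root_mu.
  apply: tendsM; first exact: tends_cst.
  exact: (tendsM pmu (tendsV dmu dpmu)).
near=> e; rewrite !normrM normfV normr_nat.
by have /xP[] : (p e)^`().[mu] != 0 by near: e; exact: nz.
Unshelve. all: by end_near. Qed.

(** Written without division, so that it is continuous in [x] and [y] across
    the diagonal. *)
Definition divided_difference (p : {poly C}) N (x y : C) : C :=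
  \sum_(k < N) p`_k * \sum_(i < k) x ^+ (k.-1 - i) * y ^+ i.

Lemma horner_divided_difference (p : {poly C}) N x y : (size p <= N)%N ->
  p.[x] - p.[y] = (x - y) * divided_difference p N x y.
Proof.
move=> szp; rewrite !(horner_coef_wide _ szp) -sumrB mulr_sumr.
by apply: eq_bigr => k _; rewrite -mulrBr subrXX mulrCA.
Qed.

Lemma divided_difference_diag (p : {poly C}) N x : (size p <= N)%N ->
  divided_difference p N x x = p^`().[x].
Proof.
move=> szp; have szp' : (size p^`() <= N.-1)%N.
  have [->|p0] := eqVneq p 0; first by rewrite deriv0 size_poly0.
  by rewrite -ltnS (leq_trans (lt_size_deriv p0)) // (leq_trans szp) // leqSpred.
rewrite (horner_coef_wide _ szp') /divided_difference.
case: N {szp szp'} => [|N]; first by rewrite !big_ord0.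
rewrite big_ord_recl big_ord0 mulr0 add0r; apply: eq_bigr => k _.
rewrite coef_deriv mulrnAl -mulrnAr; congr (_ * _).
rewrite (eq_bigr (fun=> x ^+ k)) => [|i _]; first by rewrite sumr_const card_ord.
by rewrite -exprD subnK // -ltnS.
Qed.

(** If two distinct roots converged to [mu], the divided difference of the
    polynomial would vanish at them, while it converges to the derivative at
    [mu]. *)
Lemma tends_root_unique N (p : R -> {poly C}) (p0 : {poly C}) (mu : C)
    (x y : R -> C) :
  (forall e, (size (p e) <= N)%N) ->
  (size p0 <= N)%N -> poly_tends p p0 -> p0^`().[mu] != 0 ->
  tends x mu -> tends y mu ->
  (\forall e \near 0^'+, root (p e) (x e)) ->
  (\forall e \near 0^'+, root (p e) (y e)) ->
  \forall e \near 0^'+, y e = x e.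
Proof.
move=> szp szp0 pp0 dmu xmu ymu rx ry.
have q0 : tends (fun e => divided_difference (p e) N (x e) (y e)) p0^`().[mu].
  rewrite -(divided_difference_diag mu szp0); apply: tends_sum => k.
  apply: tendsM; first exact: pp0.
  by apply: tends_sum => i; apply: tendsM; exact: tendsX.
have nz := tends_neq0 dmu q0.
near=> e; apply/esym/eqP; rewrite -subr_eq0.
have := horner_divided_difference (x e) (y e) (szp e).
have /rootP -> : root (p e) (x e) by near: e.
have /rootP -> : root (p e) (y e) by near: e.
rewrite subrr => /esym/eqP; rewrite mulf_eq0 => /orP[//|/eqP q_eq0].
have : divided_difference (p e) N (x e) (y e) != 0 by near: e.
by rewrite q_eq0 eqxx.
Unshelve. all: by end_near. Qed.
End Roots.

(** * Rescaling of the perturbed matrix *)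
Lemma eigenvalue_det (F : fieldType) n (M : 'M[F]_n) (x : F) :
  eigenvalue M x = (\det (x%:M - M) == 0).
Proof.
rewrite eigenvalue_root_char /root /char_poly; congr (_ == 0).
rewrite -[LHS]/(horner_eval x (\det (char_poly_mx M))) -det_map_mx.
congr (\det _); apply/matrixP => i j; rewrite !mxE /= /horner_eval.
by rewrite hornerD hornerN hornerC hornerMn hornerX.
Qed.

Section Rescaling.
Local Open Scope classical_set_scope.
Local Open Scope ring_scope.
Variables (R : realType) (n : nat) (A : 'M[Rmin R]_n) (a : 'M[R[i]]_n).
Variable Aeps : R -> 'M[R[i]]_n.
Hypothesis Aeps_asymp : forall i j, asymp (fun e => Aeps e i j) (a i j) (A i j).
Variables (s v : 'I_n -> R) (alpha : R) (N : {set 'I_n}) (S : rel 'I_n).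
Hypothesis s_in : forall i, i \in N -> s i = alpha.
Hypothesis s_notin : forall i, i \notin N -> s i < alpha.
Hypothesis Av : potential A s v.
Hypothesis SE : S =2 tight A s v.

(** Column [j] is multiplied by [e ^ v j], and row [i] by the inverse of
    [e ^ v i] and of its own order of magnitude [e ^ s i]. *)
Definition scaled_mx e : 'M[R[i]]_n :=
  \matrix_(i, j) ((e `^ (v j - v i - s i))%:C%C * Aeps e i j).

(** The image under the same rescaling of [e ^ alpha] on the diagonal. *)
Definition scaled_ind e i : R[i] := (e `^ (alpha - s i))%:C%C.

Definition scaled_pencil e : 'M[{poly R[i]}]_n :=
  \matrix_(i, j) ((scaled_ind e i)%:P * 'X *+ (i == j) - (scaled_mx e i j)%:P).

Lemma tends_powR (r : R) : 0 <= r ->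
  tends (fun e => (e `^ r)%:C%C) (r == 0)%:R.
Proof.
rewrite le_eqVlt => /predU1P[<-|r0].
  by rewrite eqxx; under eq_fun do rewrite powRr0; exact: tends_cst.
by rewrite gt_eqF //; exact: (tends_real (powR_cvg0 r0)).
Qed.

Lemma powR_split (e x y : R) : 0 < e -> e `^ (x + y) = e `^ x * e `^ y.
Proof. by move=> e0; rewrite powRD // (gt_eqF e0) implybT. Qed.

Lemma near_gt0 : \forall e \near (0 : R)^'+, 0 < e.
Proof. exact: nbhs_right_gt. Qed.

Lemma tends_scaled_ind i : tends (fun e => scaled_ind e i) (i \in N)%:R.
Proof.
have -> : (i \in N) = (alpha - s i == 0).
  have [iN|iN] := boolP (i \in N); first by rewrite s_in // subrr eqxx.
  by rewrite gt_eqF // subr_gt0 s_notin.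
apply: tends_powR; have [iN|iN] := boolP (i \in N); first by rewrite s_in // subrr.
by rewrite subr_ge0 ltW // s_notin.
Qed.

(** The exponent of the rescaled entry is its slack for the potential, so that
    the entries that survive in the limit are the tight ones. *)
Lemma tends_scaled_mx i j :
  tends (fun e => scaled_mx e i j) (graph_mx a S i j).
Proof.
rewrite mxE SE /tight; have := Aeps_asymp i j; case Eb: (A i j) => [b|] /= lim.
  have slack0 : 0 <= b + v j - v i - s i by have := Av Eb; lra.
  have -> : (Some b == Some (s i + v i - v j)) = (b + v j - v i - s i == 0).
    apply/eqP/eqP => [[->]|E]; first by lra.
    by congr Some; lra.
  have -> : (if b + v j - v i - s i == 0 then a i j else 0) =
      (b + v j - v i - s i == 0)%:R * a i j by case: ifP; rewrite ?mul1r ?mul0r.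
  apply: tends_near (tendsM (tends_powR slack0) lim).
  near=> e; have e0 : 0 < e by near: e; exact: near_gt0.
  rewrite mxE mulrA -rmorphM /= -powR_split //; congr ((_ `^ _)%:C%C * _); lra.
apply: tends_near (@tends_cst R 0); near=> e; rewrite mxE.
suff -> : Aeps e i j = 0 by rewrite mulr0.
by near: e.
Unshelve. all: by end_near. Qed.

Lemma scaled_pencil_tends i j :
  poly_tends (fun e => scaled_pencil e i j) (pencil N (graph_mx a S) i j).
Proof.
have tC (f : R -> R[i]) b : tends f b -> poly_tends (fun e => (f e)%:P) b%:P.
  move=> fb k; rewrite coefC; under eq_fun do rewrite coefC.
  by case: ifP => _; [exact: fb|exact: tends_cst].
rewrite mxE; under eq_fun do rewrite mxE -polyCN.
rewrite -polyCN; have hB := tC _ _ (tendsN (@tends_scaled_mx i j)).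
refine (poly_tendsD _ hB).
case: (i == j); rewrite ?mulr0n ?mulr1n; last exact: poly_tends_cst.
have -> : 'X *+ (i \in N) = ((i \in N)%:R : R[i])%:P * 'X.
  by case: (i \in N); rewrite ?mul1r ?mul0r.
exact: (poly_tendsM (tC _ _ (@tends_scaled_ind i)) (@poly_tends_cst R 'X)).
Qed.

Lemma size_scaled_pencil e i j : (size (scaled_pencil e i j) <= 2)%N.
Proof.
rewrite mxE; apply: (leq_trans (size_polyD _ _)).
rewrite geq_max size_polyN (leq_trans (size_polyC_leq1 _)) // andbT.
case: (i == j); rewrite ?mulr0n ?size_poly0 // mulr1n.
by rewrite mul_polyC (leq_trans (size_scale_leq _ _)) // size_polyX.
Qed.

Lemma horner_scaled_pencil e x : 0 < e ->
  map_mx (horner_eval x) (scaled_pencil e) =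
  diag_mx (\row_i (e `^ (- v i - s i))%:C%C) *m
    ((x * (e `^ alpha)%:C%C)%:M - Aeps e) *m diag_mx (\row_i (e `^ v i)%:C%C).
Proof.
move=> e0; apply/matrixP => i j; rewrite mul_mx_diag mul_diag_mx !mxE /horner_eval.
rewrite hornerD hornerN hornerC hornerMn hornerM hornerC hornerX mulrBr mulrBl.
congr (_ - _).
  case: eqP => [<-|_]; last by rewrite !mulr0n mulr0 mul0r.
  rewrite !mulr1n mulrCA -!mulrA mulrC; congr (_ * _).
  by rewrite -!rmorphM /= -!powR_split //; congr ((_ `^ _)%:C%C); lra.
by rewrite mulrAC -rmorphM /= -powR_split //; congr ((_ `^ _)%:C%C * _); lra.
Qed.

Lemma powRC_neq0 (e r : R) : 0 < e -> (e `^ r)%:C%C != 0 :> R[i].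
Proof. by move=> e0; rewrite fmorph_eq0 gt_eqF // powR_gt0. Qed.

Lemma root_scaled_pencil e x : 0 < e ->
  root (\det (scaled_pencil e)) x = eigenvalue (Aeps e) (x * (e `^ alpha)%:C%C).
Proof.
move=> e0; rewrite eigenvalue_det /root.
rewrite -[X in X == 0]/(horner_eval x (\det (scaled_pencil e))) -det_map_mx.
rewrite (horner_scaled_pencil _ e0) !det_mulmx !det_diag !mulf_eq0.
have prod0 (f : 'I_n -> R) :
    (\prod_i (\row_j (e `^ f j)%:C%C : 'rV[R[i]]_n) 0 i == 0) = false.
  apply/negbTE/prodf_neq0 => i _; rewrite mxE; exact: powRC_neq0.
by rewrite !prod0 orbF.
Qed.

End Rescaling.

Lemma tends_det (R : realType) n (M : R -> 'M[R[i]]_n) (M0 : 'M[R[i]]_n) :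
  (forall i j, tends (fun e => M e i j) (M0 i j)) ->
  tends (fun e => \det (M e)) (\det M0).
Proof.
move=> MM0; apply: tends_sum => p.
by apply: (tendsM (@tends_cst R _)); apply: tends_prod.
Qed.

Lemma tends_adj (R : realType) n (M : R -> 'M[R[i]]_n) (M0 : 'M[R[i]]_n) k j :
  (forall i j, tends (fun e => M e i j) (M0 i j)) ->
  tends (fun e => \adj (M e) k j) (\adj M0 k j).
Proof.
move=> MM0; rewrite mxE; under eq_fun do rewrite mxE.
apply: (tendsM (@tends_cst R _)); apply: tends_det => p q.
by rewrite !mxE; under eq_fun do rewrite !mxE; exact: MM0.
Qed.

(** * Simple eigenvalues of the limit pencil *)

(** The limit pencil involves the saturation graph of level [l], whereas [r^l]
    and [t^l] are built from [G]; both graphs have the same circuits once [G] is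
    cut down to [C^l]. *)
Lemma level_pencil_det (R : realType) n (A : 'M[Rmin R]_n) (a : 'M[R[i]]_n) k l
    (G : rel 'I_n) (V : 'cV[Rmin R]_n) :
  (0 < n)%N -> mp_irreducible A -> mp_last A k -> (0 < l <= k)%N ->
  mp_eigenvector (mp_hat A l) V ->
  G = critical_graph (mp_hat A k) \/
    (exists2 V', mp_eigenvector (mp_hat A k) V' & G = sat_graph (mp_hat A k) V') ->
  mx_r A a G l \in unitmx ->
  \det (pencil (mp_N A l) (graph_mx a (sat_graph (mp_hat A l) V))) =
  (\det (- mx_r A a G l))%:P * char_poly (mx_t A a G l) * 'X^#|~: mp_Cup A l|.
Proof.
move=> n0 A_irr k_last lk eV GE ru; have l0 : (0 < l)%N by case/andP: lk.
pose G' : rel 'I_n := fun i j => [&& G i j, i \in mp_Cup A l & j \in mp_Cup A l].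
transitivity (\det (pencil (mp_N A l) (graph_mx a G'))).
  have pencilE T : pencil (mp_N A l) (graph_mx a T) = \matrix_(i, j)
      ('X *+ (i \in mp_N A l) *+ (i == j) -
       (if T i j then map_mx (@polyC _) a i j else 0)).
    by apply/matrixP => i j; rewrite !mxE; case: ifP.
  rewrite !pencilE; apply: det_eq_cycles => c.
  exact: (cycle_sat_mp_hat_last n0 A_irr k_last).
have CE : mp_Cup A l.-1 :|: mp_C A l = mp_Cup A l by rewrite -mp_Cup_recr.
rewrite -CE; apply: det_pencil => //.
  rewrite disjoint_sym finset.disjoints_subset.
  exact: (mp_C_sub_N n0 A_irr k_last lk).
by move=> i j; rewrite CE !mxE /G'; case: (G i j) => /=; case: ifP.
Qed.
(** * The asymptotics *)

Local Open Scope classical_set_scope.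
Local Open Scope ring_scope.

Theorem theorem6p1 (R : realType) (n : nat)
    (A : 'M[Rmin R]_n) (a : 'M[R[i]]_n) (Aeps : R -> 'M[R[i]]_n)
    (k l : nat) (G : rel 'I_n) (mu : R[i]) (V : 'cV[Rmin R]_n)
    (A_irr : mp_irreducible A)
    (Aeps_germ : forall i j, germ_ring (fun e => Aeps e i j))
    (Aeps_asymp : forall i j, asymp (fun e => Aeps e i j) (a i j) (A i j))
    (k_last : mp_last A k)
    (G_def : G = critical_graph (mp_hat A k) \/
       exists2 V' : 'cV[Rmin R]_n, mp_eigenvector (mp_hat A k) V' &
         G = sat_graph (mp_hat A k) V')
    (l_range : (1 <= l <= k)%N)
    (r_inv : mx_r A a G l \in unitmx)
    (mu_neq0 : mu != 0)
    (mu_simple : simple_eigenvalue (mx_t A a G l) mu)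
    (V_eigen : mp_eigenvector (mp_hat A l) V) :
  let solution (w : 'cV[R[i]]_n) :=
    (mu *: diag_ind R (mp_N A l) - graph_mx a (sat_graph (mp_hat A l) V)) *m w
      = 0 in
  let eigenvalue_asymp (L : R -> R[i]) :=
    (\forall e \near 0^'+, eigenvalue (Aeps e) (L e)) /\
    asymp L mu (rmin_fin (mp_alpha A l)) in
  (exists w : 'cV[R[i]]_n, [/\ w != 0, solution w &
     forall w' : 'cV[R[i]]_n, solution w' -> exists c : R[i], w' = c *: w]) /\
  (exists L : R -> R[i],
     [/\ eigenvalue_asymp L,
         (forall L' : R -> R[i], eigenvalue_asymp L' ->
            \forall e \near 0^'+, L' e = L e) &
         forall (w : 'cV[R[i]]_n) (i : 'I_n) (Veps : R -> 'cV[R[i]]_n),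
           solution w -> w i 0 != 0 ->
           (\forall e \near 0^'+,
              Veps e != 0 /\ Aeps e *m Veps e = L e *: Veps e) ->
           (\forall e \near 0^'+, Veps e i 0 != 0) /\
           (forall j : 'I_n,
              asymp (fun e => Veps e j 0 / Veps e i 0) (w j 0 / w i 0)
                (rmin_fin (rmin_val (V j 0) - rmin_val (V i 0))))]).
Proof.
move=> solution eigenvalue_asymp.
have n_gt0 : (0 < n)%N.
  case: posnP => // n0; have [/eqP V0 _] := V_eigen; case: V0.
  by apply/colP => -[i lt_i]; exfalso; rewrite n0 in lt_i.
have l0 : (0 < l)%N by case/andP: l_range.
set N := mp_N A l; set S := sat_graph (mp_hat A l) V in solution *.
set s := hat_shift A l; pose v i := rmin_val (V i 0).
set alpha := mp_alpha A l in eigenvalue_asymp *.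
have [hat_pot satE] := sat_mp_hat n_gt0 A_irr k_last l_range V_eigen.
have pot : potential A s v.
  move=> i j b Eb.
  have := hat_pot i j (- s i + b); rewrite mp_hatE Eb => /(_ erefl).
  by rewrite -/(v i) -/(v j); lra.
have SE : S =2 tight A s v.
  move=> i j; rewrite /S satE /tight mp_hatE -/s -/(v i) -/(v j).
  case: (A i j) => [b|//] /=.
  by apply/eqP/eqP => -[] E; congr Some; lra.
have s_in i : i \in N -> s i = alpha by exact: hat_shift_N.
have s_notin i : i \notin N -> s i < alpha.
  rewrite inE negbK => /mp_CupP[m /andP[m0 ml] im].
  have lk : (l <= k)%N by case/andP: l_range.
  have ml' : (m < l)%N by rewrite -(prednK l0) ltnS.
  rewrite /s (@hat_shift_C _ _ _ _ n_gt0 A_irr k_last l m) // ?m0 ?(ltnW ml') //.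
  exact: (mp_alpha_lt n_gt0 A_irr k_last).
pose Q0 := pencil N (graph_mx a S); pose p0 := \det Q0.
have [root_mu deriv_mu] : p0.[mu] = 0 /\ p0^`().[mu] != 0.
  rewrite /p0 (level_pencil_det n_gt0 A_irr k_last l_range V_eigen G_def r_inv).
  apply: (simple_root_scale _ _ mu_neq0 mu_simple).
    by rewrite -unitfE -unitmxE -scaleN1r unitmxZ ?unitrN1.
  by rewrite monic_neq0 // char_poly_monic.
have Q0mu : map_mx (horner_eval mu) Q0 = mu *: diag_ind R N - graph_mx a S.
  exact: horner_pencil.
have [k0 [j0 adj0]] := adj_neq0_simple_root n_gt0 root_mu deriv_mu.
pose M0 := mu *: diag_ind R N - graph_mx a S.
have {}adj0 : \adj M0 k0 j0 != 0 by rewrite /M0 -Q0mu -map_mx_adj mxE.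
have detM0 : \det M0 = 0.
  by rewrite /M0 -Q0mu -[RHS]root_mu; exact: det_map_mx.
pose z : 'cV[R[i]]_n := col j0 (\adj M0).
have zE i : z i 0 = \adj M0 i j0 by rewrite mxE.
have z0 : z != 0 by apply/eqP => /colP/(_ k0); rewrite zE [RHS]mxE; exact/eqP.
have z_sol : solution z.
  by rewrite /solution -/M0 /z colE mulmxA mul_mx_adj detM0 mul_scalar_mx scale0r.
have sol_z w : solution w -> w = (w k0 0 / z k0 0) *: z.
  move=> Mw; apply/colP => i; rewrite mxE !zE mulrAC.
  by rewrite -(adj_kernel_proportional k0 j0 i Mw) mulrAC divff // mul1r.
split; first by exists z; split=> // w /sol_z ->; eexists.
(* At [e > 0], the roots of [p e] times [e ^ alpha] are the eigenvalues of
   [Aeps e]. *)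
pose Q e := scaled_pencil Aeps s v alpha e; pose p e := \det (Q e).
have Q_tends i j : poly_tends (fun e => Q e i j) (Q0 i j).
  exact: (scaled_pencil_tends Aeps_asymp s_in s_notin pot SE).
have p_tends : poly_tends p p0 by exact: poly_tends_det Q_tends.
have size_p e : (size (p e) <= n.+1)%N.
  by apply: size_det_leq => i j; exact: size_scaled_pencil.
have Q0_size i j : (size (Q0 i j) <= 2)%N.
  rewrite mxE; apply: (leq_trans (size_polyD _ _)).
  rewrite geq_max size_polyN (leq_trans (size_polyC_leq1 _)) // andbT.
  case: (i == j); case: (i \in N);
    by rewrite ?mulr0n ?mul0rn ?mulr1n ?size_poly0 ?size_polyX.
have size_p0 : (size p0 <= n.+1)%N by exact: size_det_leq.
have [lam lam_mu lam_root] := tends_root size_p size_p0 p_tends root_mu deriv_mu.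
pose L e := lam e * (e `^ alpha)%:C%C.
have powC0 (e r : R) : 0 < e -> (e `^ r)%:C%C != 0 :> R[i] by exact: powRC_neq0.
exists L; split.
- split.
    near=> e; have e0 : 0 < e by near: e; exact: near_gt0.
    by rewrite /L -(root_scaled_pencil Aeps s v) //; near: e.
  apply: tends_near lam_mu; near=> e; have e0 : 0 < e by near: e; exact: near_gt0.
  by rewrite /L mulrCA -rmorphM /= -powR_split // addNr powRr0 mulr1.
- move=> L' [eig' asymp'].
  pose lam' e := (e `^ (- alpha))%:C%C * L' e.
  have L'E e : 0 < e -> L' e = lam' e * (e `^ alpha)%:C%C.
    by move=> e0; rewrite /lam' mulrAC -rmorphM /= -powR_split // addNr powRr0 mul1r.
  have lam'_root : \forall e \near 0^'+, root (p e) (lam' e).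
    near=> e; have e0 : 0 < e by near: e; exact: near_gt0.
    by rewrite root_scaled_pencil // -L'E //; near: e.
  have uniq_lam := tends_root_unique size_p size_p0 p_tends deriv_mu lam_mu asymp'
    lam_root lam'_root.
  near=> e; have e0 : 0 < e by near: e; exact: near_gt0.
  by rewrite L'E // /L; congr (_ * _); near: e.
move=> w i0 Veps w_sol wi0 Veps_eig.
pose M e := map_mx (horner_eval (lam e)) (Q e).
have M_tends i j : tends (fun e => M e i j) (M0 i j).
  rewrite /M0 -Q0mu mxE; under eq_fun do rewrite mxE.
  apply: (tends_horner _ (Q0_size i j) (Q_tends i j) lam_mu) => e.
  exact: size_scaled_pencil.
have adj_tends i j : tends (fun e => \adj (M e) i j) (\adj M0 i j).
  exact: tends_adj.
have [c wE] : exists c, forall i, w i 0 = c * \adj M0 i j0.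
  exists (w k0 0 / z k0 0) => i.
  by have /colP/(_ i) := sol_z _ w_sol; rewrite [RHS]mxE [z i 0]zE.
have zi0 : \adj M0 i0 j0 != 0.
  by apply: contraNneq wi0 => adjz0; rewrite wE adjz0 mulr0.
have adj_nz := tends_neq0 zi0 (adj_tends i0 j0).
pose u e : 'cV[R[i]]_n := \col_j ((e `^ (- v j))%:C%C * Veps e j 0).
have u_ker : \forall e \near 0^'+, M e *m u e = 0.
  near=> e; have e0 : 0 < e by near: e; exact: near_gt0.
  have [_ eig] : Veps e != 0 /\ Aeps e *m Veps e = L e *: Veps e by near: e.
  rewrite /M (horner_scaled_pencil _ _ _ _ _ e0) -/(L e).
  have -> : u e = diag_mx (\row_i (e `^ (- v i))%:C%C) *m Veps e.
    by apply/colP => i; rewrite mul_diag_mx !mxE.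
  rewrite -!mulmxA (mulmxA (diag_mx _) (diag_mx _)).
  have -> : diag_mx (\row_i (e `^ v i)%:C%C) *m diag_mx (\row_i (e `^ (- v i))%:C%C)
      = 1%:M :> 'M[R[i]]_n.
    apply/matrixP => i j; rewrite mul_diag_mx !mxE; have [->|_] := eqVneq i j.
      by rewrite !mulr1n -rmorphM /= -powR_split // subrr powRr0.
    by rewrite !mulr0n mulr0.
  by rewrite mul1mx mulmxBl mul_scalar_mx eig subrr mulmx0.
have ratio : \forall e \near 0^'+, forall i,
    \adj (M e) i0 j0 * u e i 0 = u e i0 0 * \adj (M e) i j0.
  near=> e => i; apply: adj_kernel_proportional; near: e; exact: u_ker.
have Veps_nz : \forall e \near 0^'+, Veps e i0 0 != 0.
  near=> e; have e0 : 0 < e by near: e; exact: near_gt0.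
  have [/eqP Vne _] : Veps e != 0 /\ Aeps e *m Veps e = L e *: Veps e by near: e.
  have adj_ne : \adj (M e) i0 j0 != 0 by near: e.
  have rat : forall i, \adj (M e) i0 j0 * u e i 0 = u e i0 0 * \adj (M e) i j0.
    by near: e.
  apply/eqP => Vi0; apply: Vne; apply/colP => i.
  have := rat i; rewrite [u e i0 0]mxE Vi0 mulr0 mul0r => /eqP.
  rewrite mulf_eq0 (negPf adj_ne) mxE mulf_eq0 (negPf (powC0 _ _ e0)) => /eqP ->.
  by rewrite mxE.
split=> // j.
have -> : w j 0 / w i0 0 = \adj M0 j j0 / \adj M0 i0 j0.
  have c0 : c != 0 by apply: contraNneq wi0 => c0; rewrite wE c0 mul0r.
  by rewrite !wE invfM mulrACA divff // mul1r.
apply: tends_near (tendsM (adj_tends j j0) (tendsV zi0 (adj_tends i0 j0))).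
near=> e; have e0 : 0 < e by near: e; exact: near_gt0.
have adj_ne : \adj (M e) i0 j0 != 0 by near: e.
have Vne : Veps e i0 0 != 0 by near: e.
have rat : forall i, \adj (M e) i0 j0 * u e i 0 = u e i0 0 * \adj (M e) i j0.
  by near: e.
have -> : \adj (M e) j j0 / \adj (M e) i0 j0 = u e j 0 / u e i0 0.
  have une : u e i0 0 != 0 by rewrite mxE mulf_neq0 ?(powC0 _ _ e0).
  by apply/eqP; rewrite (eqr_div _ _ adj_ne une) mulrC -rat mulrC.
rewrite !mxE invfM mulrACA; congr (_ * _).
rewrite -fmorphV -powRN opprK -rmorphM /= -powR_split //.
by congr ((_ `^ _)%:C%C); rewrite /v; lra.
Unshelve. all: by end_near. Qed.
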